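(* Greatest common divisors exist in the ring $\mathcal{E}$ of entire functions on $\mathbf{F}^m$: for any $f_1,\dots,f_k\in\mathcal{E}$ there is $G\in\mathcal{E}$ which is a greatest common divisor of $f_1,\dots,f_k$ in $\mathcal{E}$. Moreover, if $G$ is a greatest common divisor of $f_1,\dots,f_k$ in $\mathcal{E}$, then (restricted to $\mathbf{B}^m(r)$) $G$ is also a greatest common divisor of $f_1,\dots,f_k$ in the ring $\mathcal{A}^m(r)$ for every $r\in|\mathbf{F}^\times|$.
   Context: $\mathbf{F}$ is an algebraically closed field complete with respect to a non-trivial non-Archimedean absolute value $|\cdot|$; $|\mathbf{F}^\times|=\{|a|:a\in\mathbf{F}\setminus\{0\}\}$ is its value group. For $r\in|\mathbf{F}^\times|$, $\mathbf{B}^m(r)=\{z\in\mathbf{F}^m:\max_i|z_i|\le r\}$, and $\mathcal{A}^m(r)$ is the ring of formal power series $\sum_\gamma a_\gamma z^\gamma$ (multi-index notation, $z=(z_1,\dots,z_m)$, $|\gamma|=\gamma_1+\dots+\gamma_m$) with coefficients in $\mathbf{F}$ such that $|a_\gamma|r^{|\gamma|}\to0$ as $|\gamma|\to\infty$ (analytic functions on $\mathbf{B}^m(r)$). An entire function on $\mathbf{F}^m$ is a power series lying in $\mathcal{A}^m(r)$ for every $r\in|\mathbf{F}^\times|$; these form an integral domain $\mathcal{E}$, which is a subring of each $\mathcal{A}^m(r)$ (by restriction). Divisibility, units and greatest common divisors are taken in the indicated ring. *)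

(* Defs.v *)
From Stdlib Require Import Reals.
From HB Require Import structures.
From mathcomp Require Import all_boot all_order all_algebra.
Set Implicit Arguments. Unset Strict Implicit. Unset Printing Implicit Defensive.
Import GRing.Theory.
Local Open Scope ring_scope.

Definition is_nonarch_abs (F : fieldType) (abs : F -> R) : Prop :=
  (forall x : F, Rle R0 (abs x)) /\
  (forall x : F, abs x = R0 <-> x = 0) /\
  (forall x y : F, abs (x * y) = Rmult (abs x) (abs y)) /\
  (forall x y : F, Rle (abs (x + y)) (Rmax (abs x) (abs y))).

Definition abs_nontrivial (F : fieldType) (abs : F -> R) : Prop :=
  exists a : F, a <> 0 /\ abs a <> R1.

Definition abs_complete (F : fieldType) (abs : F -> R) : Prop :=
  forall u : nat -> F,
    (forall eps, Rlt R0 eps -> exists N : nat, forall p q : nat,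
        (N <= p)%N -> (N <= q)%N -> Rlt (abs (u p - u q)) eps) ->
    exists l : F, forall eps, Rlt R0 eps -> exists N : nat, forall n : nat,
        (N <= n)%N -> Rlt (abs (u n - l)) eps.

Definition in_value_group (F : fieldType) (abs : F -> R) (r : R) : Prop :=
  exists a : F, a <> 0 /\ abs a = r.

Definition mindex (m : nat) := {ffun 'I_m -> nat}.

Definition mdeg (m : nat) (g : mindex m) : nat := (\sum_(i < m) g i)%N.

Definition pseries (F : fieldType) (m : nat) := mindex m -> F.

Definition mi_of (m n : nat) (a : {ffun 'I_m -> 'I_n}) : mindex m :=
  [ffun i => nat_of_ord (a i)].

Definition mi_sub (m : nat) (g a : mindex m) : mindex m :=
  [ffun i => (g i - a i)%N].

(* Cauchy product: (f g)_gamma = sum_{alpha <= gamma} f_alpha g_(gamma-alpha);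
   every alpha <= gamma has components <= |gamma|, so ranges over a finite box. *)
Definition psmul (F : fieldType) (m : nat) (f g : pseries F m) : pseries F m :=
  fun gam =>
    \sum_(a : {ffun 'I_m -> 'I_(mdeg gam).+1} | [forall i, (a i <= gam i)%N])
       f (mi_of a) * g (mi_sub gam (mi_of a)).

Definition in_A (F : fieldType) (abs : F -> R) (m : nat) (r : R)
    (f : pseries F m) : Prop :=
  forall eps, Rlt R0 eps -> exists N : nat, forall gam : mindex m,
    (N <= mdeg gam)%N -> Rlt (Rmult (abs (f gam)) (pow r (mdeg gam))) eps.

Definition entire (F : fieldType) (abs : F -> R) (m : nat) (f : pseries F m) : Prop :=
  forall r : R, in_value_group abs r -> in_A abs r f.

Definition ps_divides (F : fieldType) (m : nat) (S : pseries F m -> Prop)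
    (g f : pseries F m) : Prop :=
  exists h : pseries F m, S h /\ forall gam, f gam = psmul g h gam.

Definition ps_is_gcd (F : fieldType) (m k : nat) (S : pseries F m -> Prop)
    (f : 'I_k -> pseries F m) (G : pseries F m) : Prop :=
  S G /\
  (forall i : 'I_k, ps_divides S G (f i)) /\
  (forall H : pseries F m, S H -> (forall i : 'I_k, ps_divides S H (f i)) ->
      ps_divides S H G).

(* Main.v *)
(** Write A(r) for the power series converging on the ball of radius r.
    Rescaling the variables by an element of absolute value r turns A(r) into
    A = A(1), and a smaller radius becomes the endomorphism [scl t], |t| <= 1,
    of A.

    Greatest common divisors in A, by induction on m.  After a generic shear f
    is distinguished in one variable X (its dominant monomial is a power of X),
    both at the given radius and at a smaller one.  By Weierstrass division f is
    associated to a polynomial in X, and g is congruent to one modulo f, with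
    coefficients in the ring D of m-1 variables, a gcd domain.  Gauss' lemma in
    D[X] yields a common divisor G and a Bezout relation u f + v g = c G with
    c <> 0 in D.  If H divides f and g, even after shrinking the radius, then H is
    distinguished too; dividing G = q H + s, H divides c G, hence c s, whose
    X-degree is too small: s = 0, so H divides G.  Hence gcds survive restriction
    to smaller balls.

    Let G_n be a gcd on the ball of radius r_n -> oo.  Then G_(n+1) = u_n G_n with
    u_n a unit on that ball; normalised to have constant term 1, u_n - 1 has norm
    at most r_j / r_n on the ball of radius r_j, so the products of the u_n
    converge to units and G_0 times their product is entire and a gcd on every
    ball. *)
Require Import Defs.
From Stdlib Require Import Reals Lra.
(* [field] for the Stdlib reals; the name is shadowed by the import of [ring] below. *)
Ltac real_field := field.
From HB Require Import structures.
From mathcomp Require Import all_boot all_order all_algebra.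
From mathcomp Require Import boolp mpoly ring.

Set Implicit Arguments. Unset Strict Implicit. Unset Printing Implicit Defensive.
Import Order.TTheory GRing.Theory.
Local Open Scope ring_scope.
Delimit Scope R_scope with coqR.

(** * Formal power series *)

Record fps (F : fieldType) (m : nat) := Fps { fcoef :> 'X_{1..m} -> F }.

HB.instance Definition _ (F : fieldType) m := gen_eqMixin (fps F m).
HB.instance Definition _ (F : fieldType) m := gen_choiceMixin (fps F m).

Section FpsRing.
Variables (F : fieldType) (m : nat).
Implicit Types f g h : fps F m.

Lemma fpsP f g : (forall a, f a = g a) -> f = g.
Proof. by case: f => f; case: g => g /= e; congr Fps; apply: funext. Qed.

Definition fps0 : fps F m := Fps (fun=> 0).
Definition fps_add f g : fps F m := Fps (fun a => f a + g a).
Definition fps_opp f : fps F m := Fps (fun a => - f a).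

Lemma fps_addA : associative fps_add.
Proof. by move=> f g h; apply: fpsP => a /=; rewrite addrA. Qed.
Lemma fps_addC : commutative fps_add.
Proof. by move=> f g; apply: fpsP => a /=; rewrite addrC. Qed.
Lemma fps_add0 : left_id fps0 fps_add.
Proof. by move=> f; apply: fpsP => a /=; rewrite add0r. Qed.
Lemma fps_addN : left_inverse fps0 fps_opp fps_add.
Proof. by move=> f; apply: fpsP => a /=; rewrite addNr. Qed.

HB.instance Definition _ :=
  GRing.isZmodule.Build (fps F m) fps_addA fps_addC fps_add0 fps_addN.

(** Truncations let the ring axioms, and later linear substitutions, be inherited from [{mpoly
    F[m]}] degree by degree. *)
Definition trunc n f : {mpoly F[m]} := \sum_(a : 'X_{1..m < n.+1}) f a *: 'X_[a].

Lemma truncE n f a : (trunc n f)@_a = if (mdeg a <= n)%N then f a else 0.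
Proof.
rewrite /trunc raddf_sum /=; case: ifP => an.
  rewrite (bigD1 (BMultinom (an : mdeg a < n.+1)%N)) //= mcoeffZ mcoeffX eqxx mulr1.
  rewrite big1 ?addr0 // => b ba; rewrite mcoeffZ mcoeffX.
  by case: eqP => [e|]; rewrite ?mulr0 //; case/eqP: ba; apply/eqP; rewrite bmeqP /= e.
rewrite big1 // => b _; rewrite mcoeffZ mcoeffX.
by case: eqP => [e|]; rewrite ?mulr0 //; move: (bmdeg b); rewrite e ltnS an.
Qed.

Definition fps_mul f g : fps F m :=
  Fps (fun a => \sum_(k : 'X_{1..m < (mdeg a).+1, (mdeg a).+1} | a == (k.1 + k.2)%MM)
         f k.1 * g k.2).

Lemma fps_mul_trunc n f g a : (mdeg a <= n)%N ->
  fps_mul f g a = (trunc n f * trunc n g)@_a.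
Proof.
move=> an; rewrite mcoeffM; apply: eq_bigr => k _; rewrite !truncE.
by rewrite !(leq_trans _ an) //; rewrite -ltnS bmdeg.
Qed.

(** A monomial of degree at most n has only divisors of degree at most n, so low coefficients of a
    product see only low coefficients of the factors. *)
Lemma mcoeffM_low n (p p' q q' : {mpoly F[m]}) :
  (forall a, (mdeg a <= n)%N -> p@_a = p'@_a) ->
  (forall a, (mdeg a <= n)%N -> q@_a = q'@_a) ->
  forall a, (mdeg a <= n)%N -> (p * q)@_a = (p' * q')@_a.
Proof.
move=> hp hq a an; rewrite !mcoeffM; apply: eq_bigr => k _.
by rewrite hp ?hq //; apply: leq_trans an; rewrite -ltnS bmdeg.
Qed.

Lemma trunc_mul n f g a : (mdeg a <= n)%N ->
  (trunc n (fps_mul f g))@_a = (trunc n f * trunc n g)@_a.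
Proof. by move=> an; rewrite truncE an (fps_mul_trunc _ _ an). Qed.

Definition fpsX b : fps F m := Fps (fun a => (b == a)%:R).

Lemma trunc_fpsX n b a : (mdeg a <= n)%N -> (trunc n (fpsX b))@_a = ('X_[b])@_a.
Proof. by move=> an; rewrite truncE an mcoeffX. Qed.

Lemma fps_mulA : associative fps_mul.
Proof.
move=> f g h; apply: fpsP => a; rewrite !(fps_mul_trunc (n := mdeg a)) //.
rewrite (@mcoeffM_low (mdeg a) _ (trunc (mdeg a) f) _ (trunc (mdeg a) g * trunc (mdeg a) h)) //;
  last by move=> b; apply: trunc_mul.
rewrite mulrA; apply: (@mcoeffM_low (mdeg a)) => // b hb.
by rewrite trunc_mul.
Qed.
Lemma fps_mulC : commutative fps_mul.
Proof.
by move=> f g; apply: fpsP => a; rewrite !(fps_mul_trunc (n := mdeg a)) // mulrC.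
Qed.
Lemma fps_mul1 : left_id (fpsX 0%MM) fps_mul.
Proof.
move=> f; apply: fpsP => a; rewrite !(fps_mul_trunc (n := mdeg a)) //.
rewrite (@mcoeffM_low (mdeg a) _ 1 _ (trunc (mdeg a) f)) //.
  by rewrite mul1r truncE leqnn.
by move=> b hb; rewrite trunc_fpsX // mpolyX0.
Qed.
Lemma fps_mulDl : left_distributive fps_mul +%R.
Proof.
move=> f g h; apply: fpsP => a /=; rewrite -big_split; apply: eq_bigr => k _.
by rewrite mulrDl.
Qed.
Lemma fps_1neq0 : fpsX 0%MM != 0 :> fps F m.
Proof.
apply/eqP => /(congr1 (fun f : fps F m => f 0%MM)) /=.
by rewrite eqxx => /eqP; rewrite oner_eq0.
Qed.

HB.instance Definition _ :=
  GRing.Zmodule_isComNzRing.Build (fps F m) fps_mulA fps_mulC fps_mul1 fps_mulDl fps_1neq0.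

Lemma coef_add f g a : (f + g) a = f a + g a. Proof. by []. Qed.
Lemma coef_opp f a : (- f) a = - f a. Proof. by []. Qed.
Lemma coef_0 a : (0 : fps F m) a = 0. Proof. by []. Qed.
Lemma coef_1 a : (1 : fps F m) a = (0%MM == a)%:R. Proof. by []. Qed.
Lemma coef_mul f g a : (f * g) a =
  \sum_(k : 'X_{1..m < (mdeg a).+1, (mdeg a).+1} | a == (k.1 + k.2)%MM) f k.1 * g k.2.
Proof. by []. Qed.
Lemma coef_mul_trunc n f g a : (mdeg a <= n)%N -> (f * g) a = (trunc n f * trunc n g)@_a.
Proof. exact: fps_mul_trunc. Qed.

Lemma lem_addr_sub (a b : 'X_{1..m}) : (a <= b)%MM -> (a + (b - a) = b)%MM.
Proof. by move=> ab; rewrite addmC submK. Qed.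

(** Any duplicate-free enumeration of the divisors of a may index the product; later comparisons of
    products each pick a convenient one. *)
Lemma coef_mul_seq (s : seq 'X_{1..m}) f g a : uniq s -> s =i [pred b | (b <= a)%MM] ->
  (f * g) a = \sum_(b <- s) f b * g (a - b)%MM.
Proof.
move=> us hs; rewrite coef_mul.
pose d := (mdeg a).+1.
have bd b : (b <= a)%MM -> (mdeg b < d)%N.
  by move=> ba; rewrite ltnS -(submK ba) mdegD leq_addl.
have sd b : (mdeg (a - b)%MM < d)%N by rewrite ltnS mdegB.
pose T := ('X_{1..m < d, d})%type.
pose r := filter (fun k : T => a == (k.1 + k.2)%MM) (index_enum T).
rewrite -big_filter -/r.
rewrite (eq_big_seq (fun k : T => f k.1 * g (a - k.1)%MM)); last first.
  move=> k; rewrite mem_filter => /andP[/eqP e _].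
  by have := addmK (val k.1) (val k.2); rewrite addmC -e => ->.
rewrite -(big_map (fun k : T => k.1 : 'X_{1..m}) xpredT (fun b => f b * g (a - b)%MM)).
apply: perm_big; apply: uniq_perm => //.
  rewrite map_inj_in_uniq ?filter_uniq ?index_enum_uniq // => -[k l] [k' l'].
  rewrite !mem_filter /= => /andP[/eqP e _] /andP[/eqP e' _] kk.
  congr (_, _); apply: val_inj => //=.
  by apply: (@addmI _ (val k)); rewrite -e e' /= kk.
move=> b; rewrite hs inE; apply/mapP/idP => [[k]|ba].
  by rewrite mem_filter => /andP[/eqP-> _] ->; rewrite lem_addr.
exists (BMultinom (bd _ ba), BMultinom (sd b)) => //.
by rewrite mem_filter mem_index_enum /= lem_addr_sub ?eqxx.
Qed.

End FpsRing.

(** * Monomials, rescaling and constants *)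

Section Monomials.
Variables (F : fieldType) (m : nat).
Implicit Types f g : fps F m.

Definition below (a : 'X_{1..m}) : seq 'X_{1..m} :=
  [seq b <- map val (enum {: 'X_{1..m < (mdeg a).+1}}) | (b <= a)%MM].

Lemma below_uniq a : uniq (below a).
Proof. by rewrite filter_uniq // map_inj_uniq ?enum_uniq //; apply: val_inj. Qed.

Lemma mem_below a : below a =i [pred b | (b <= a)%MM].
Proof.
move=> b; rewrite mem_filter !inE andb_idr // => ba; apply/mapP.
have h : (mdeg b < (mdeg a).+1)%N by rewrite ltnS -(submK ba) mdegD leq_addl.
by exists (BMultinom h); rewrite ?mem_enum.
Qed.

Lemma coef_mulX f b a :
  (f * fpsX F b) a = if (b <= a)%MM then f (a - b)%MM else 0.
Proof.
rewrite (coef_mul_seq _ _ (below_uniq a) (@mem_below a)).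
case: ifP => ba.
  rewrite (bigD1_seq (a - b)%MM) ?below_uniq ?mem_below ?inE ?lem_subr //=.
  rewrite big_seq_cond big1 => [|c].
    rewrite (_ : (a - (a - b))%MM = b) ?eqxx ?mulr1 ?addr0 //.
    by apply/mnmP => i; rewrite !mnmBE subKn //; move/mnm_lepP: ba; apply.
  rewrite mem_below !inE /= => /andP[ca cb]; case: eqP; rewrite ?mulr0 // => e.
  case/eqP: cb; rewrite e; apply/mnmP => i; rewrite !mnmBE subKn //.
  by move/mnm_lepP: ca; apply.
rewrite big_seq big1 // => c; rewrite mem_below inE /= => ca.
by case: eqP; rewrite ?mulr0 // => e; rewrite e lem_subr in ba.
Qed.

Lemma fpsX_exp b n : fpsX F b ^+ n = fpsX F (b *+ n)%MM :> fps F m.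
Proof.
elim: n => [|n ih]; first by rewrite mulm0n.
apply: fpsP => a; rewrite exprSr ih coef_mulX /= mulmSr.
case: ifP => [ba|/negbT ba].
  congr (_%:R); congr nat_of_bool; apply/eqP/eqP => [->|<-]; last by rewrite addmK.
  by rewrite submK.
by case: eqP => // e; move: ba; rewrite -e lem_addl.
Qed.

(** Substitution of r z for z: [scl r f] converges on the unit ball when f does on the ball of
    radius |r|. *)
Definition scl (r : F) f : fps F m := Fps (fun a => f a * r ^+ mdeg a).

Lemma coef_scl r f a : scl r f a = f a * r ^+ mdeg a. Proof. by []. Qed.

Lemma scl_additive r : additive (scl r).
Proof. by move=> f g; apply: fpsP => a /=; rewrite mulrBl. Qed.
HB.instance Definition _ r :=
  GRing.isAdditive.Build (fps F m) (fps F m) (scl r) (scl_additive r).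

Lemma scl_multiplicative r : multiplicative (scl r).
Proof.
split=> [f g|]; apply: fpsP => a.
  rewrite coef_scl !coef_mul mulr_suml; apply: eq_bigr => k /eqP e /=.
  by rewrite mulrACA -exprD -mdegD -e.
by rewrite coef_scl !coef_1; case: eqP => [<-|]; rewrite ?mul0r // mdeg0 expr0 mulr1.
Qed.
HB.instance Definition _ r :=
  GRing.isMultiplicative.Build (fps F m) (fps F m) (scl r) (scl_multiplicative r).

Lemma sclM r s f : scl r (scl s f) = scl (r * s) f.
Proof. by apply: fpsP => a /=; rewrite -mulrA exprMn [s ^+ _ * _]mulrC. Qed.

Lemma scl1 f : scl 1 f = f.
Proof. by apply: fpsP => a /=; rewrite expr1n mulr1. Qed.

Lemma sclK r : r != 0 -> cancel (scl r) (scl r^-1).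
Proof. by move=> r0 f; rewrite sclM mulVf // scl1. Qed.

Definition cst (c : F) : fps F m := Fps (fun a => if a == 0%MM then c else 0).

Lemma coef_cst c f a : (cst c * f) a = c * f a.
Proof.
have -> : cst c * f = Fps (fun a => c * f a); last by [].
apply: fpsP => {}a; rewrite mulrC (coef_mul_seq _ _ (below_uniq a) (@mem_below a)).
rewrite (bigD1_seq a) ?below_uniq ?mem_below ?inE ?lepm_refl //=.
have -> : (a - a)%MM = 0%MM by apply/mnmP => i; rewrite mnmBE mnm0E subnn.
rewrite eqxx big_seq_cond big1 ?addr0 1?mulrC // => b.
rewrite mem_below !inE /= => /andP[ba nba].
case: eqP; rewrite ?mulr0 // => e; case/eqP: nba.
by rewrite -[RHS](lem_addr_sub ba) e addm0.
Qed.
End Monomials.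

(** * Adjoining a main variable, of index 0 *)

Section Extend.
Variables (F : fieldType) (m : nat).

Definition consm n (a : 'X_{1..m}) : 'X_{1..m.+1} :=
  [multinom (if unlift ord0 i is Some j then a j else n) | i < m.+1].
Definition tailm (a : 'X_{1..m.+1}) : 'X_{1..m} := [multinom a (lift ord0 i) | i < m].

Lemma consm0 n a : consm n a ord0 = n. Proof. by rewrite mnmE unlift_none. Qed.
Lemma consmS n a i : consm n a (lift ord0 i) = a i. Proof. by rewrite mnmE liftK. Qed.
Lemma tail_cons n a : tailm (consm n a) = a.
Proof. by apply/mnmP => i; rewrite mnmE consmS. Qed.
Lemma cons_tail (a : 'X_{1..m.+1}) : consm (a ord0) (tailm a) = a.
Proof.
apply/mnmP => i; rewrite mnmE; case: unliftP => [j ->|-> //].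
by rewrite mnmE.
Qed.
Lemma mdeg_cons n a : mdeg (consm n a) = (n + mdeg a)%N.
Proof.
rewrite !mdegE big_ord_recl consm0; congr addn.
by apply: eq_bigr => i _; rewrite consmS.
Qed.
Lemma tailmB (a b : 'X_{1..m.+1}) : tailm (a - b)%MM = (tailm a - tailm b)%MM.
Proof. by apply/mnmP => i; rewrite !mnmE. Qed.

Definition ext (f : fps F m) : fps F m.+1 :=
  Fps (fun a => if a ord0 == 0%N then f (tailm a) else 0).

Lemma coef_ext f (a : 'X_{1..m.+1}) : ext f a = if a ord0 == 0%N then f (tailm a) else 0.
Proof. by []. Qed.

Lemma ext_additive : additive ext.
Proof. by move=> f g; apply: fpsP => a /=; case: ifP => //; rewrite subr0. Qed.
HB.instance Definition _ :=
  GRing.isAdditive.Build (fps F m) (fps F m.+1) ext ext_additive.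

Lemma ext_multiplicative : multiplicative ext.
Proof.
split=> [f g|]; apply: fpsP => a; last first.
  rewrite coef_ext !coef_1; case: eqP => [a0|/eqP a0].
    congr (_%:R); congr nat_of_bool; apply/eqP/eqP => e.
      by rewrite -(cons_tail a) -e a0; apply/mnmP => i; rewrite !mnmE; case: unlift => // j; rewrite mnm0E.
    by rewrite -e; apply/mnmP => i; rewrite !mnmE.
  by case: eqP => // e; rewrite -e mnm0E in a0.
rewrite coef_ext; case: eqP => [a0|/eqP a0]; last first.
  rewrite coef_mul big1 // => k /eqP /(congr1 (fun b : 'X_{1..m.+1} => b ord0)) e /=.
  move: a0; rewrite e mnmDE addn_eq0.
  by case: eqP => _ /=; rewrite ?mul0r // => /negbTE->; rewrite mulr0.
rewrite (coef_mul_seq _ _ (below_uniq _) (@mem_below _ _)).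
rewrite (@coef_mul_seq _ _ (map (consm 0) (below (tailm a)))).
- rewrite big_map; apply: eq_bigr => b _ /=.
  by rewrite consm0 eqxx mnmBE consm0 a0 tailmB !tail_cons.
- rewrite map_inj_uniq ?below_uniq // => b c e.
  by rewrite -(tail_cons 0 b) e tail_cons.
move=> b; rewrite inE; apply/mapP/mnm_lepP => [[c]|ba].
  rewrite mem_below inE => /mnm_lepP ca -> i; rewrite mnmE.
  by case: unliftP => [j ->|->] //; have := ca j; rewrite mnmE.
exists (tailm b); last first.
  by rewrite -{1}(cons_tail b); congr consm; move: (ba ord0); rewrite a0 leqn0 => /eqP.
by rewrite mem_below inE; apply/mnm_lepP => i; rewrite !mnmE.
Qed.
HB.instance Definition _ :=
  GRing.isMultiplicative.Build (fps F m) (fps F m.+1) ext ext_multiplicative.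

Definition mainX : fps F m.+1 := fpsX F U_(ord0)%MM.

(** Different powers of the main variable meet disjoint sets of monomials, so at most one term of
    the sum contributes to a given coefficient. *)
Lemma coef_horner (p : {poly fps F m}) (a : 'X_{1..m.+1}) :
  (map_poly ext p).[mainX] a = p`_(a ord0) (tailm a).
Proof.
rewrite horner_coef.
have sumE n (G : 'I_n -> fps F m.+1) : (\sum_i G i) a = \sum_i G i a.
  by elim/big_rec2: _ => //= i x y _ <-.
rewrite sumE; set N := size _.
have E i : ((map_poly ext p)`_i * mainX ^+ i) a = if i == a ord0 then p`_i (tailm a) else 0.
  rewrite coef_map fpsX_exp coef_mulX /=.
  have le : (U_(ord0) *+ i <= a)%MM = (i <= a ord0)%N.
    apply/mnm_lepP/idP => [/(_ ord0)|h j]; rewrite mulmnE mnm1E; first by rewrite eqxx mul1n.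
    by case: eqP => [<-|_]; rewrite ?mul1n.
  rewrite le mnmBE mulmnE mnm1E eqxx mul1n subn_eq0.
  case: (ltngtP i (a ord0)) => // e; congr (p`_i _).
  by apply/mnmP => j; rewrite !mnmE /= mulmnE mnm1E subn0.
under eq_bigr do rewrite E.
have [lt|ge] := ltnP (a ord0) N.
  rewrite (bigD1 (Ordinal lt)) //= eqxx big1 ?addr0 // => i ne.
  by case: eqP => // e; case/eqP: ne; apply: val_inj.
rewrite big1 => [|i _]; last first.
  by case: eqP => // e; move: (ltn_ord i); rewrite e ltnNge ge.
(* N is the size of the mapped polynomial, so the vanishing of the coefficient of p is read off
   through [ext]. *)
have := congr1 (fun f : fps F m.+1 => f (consm 0 (tailm a))) (nth_default 0 ge).
by rewrite coef_map /= consm0 eqxx tail_cons.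
Qed.

End Extend.

(** * Convergent series and their dominant monomial *)

Section Nonarch.
Variables (F : fieldType) (abs : F -> R) (habs : is_nonarch_abs abs).
Implicit Types x y : F.

Lemma abs_ge0 x : (0 <= abs x)%coqR. Proof. by case: habs. Qed.
Lemma abs_eq0 x : abs x = 0%coqR <-> x = 0. Proof. by case: habs => _ []. Qed.
Lemma absM x y : abs (x * y) = (abs x * abs y)%coqR.
Proof. by case: habs => _ [_ []]. Qed.
Lemma absD x y : (abs (x + y) <= Rmax (abs x) (abs y))%coqR.
Proof. by case: habs => _ [_ []]. Qed.
Lemma abs0 : abs 0 = 0%coqR. Proof. exact/abs_eq0. Qed.
Lemma abs_gt0 x : x != 0 -> (0 < abs x)%coqR.
Proof.
move=> /eqP x0; case: (Rle_lt_or_eq_dec _ _ (abs_ge0 x)) => // e.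
by case: x0; apply/abs_eq0.
Qed.
Lemma abs1 : abs 1 = 1%coqR.
Proof.
have := absM 1 1; rewrite mulr1 => e.
have p : (0 < abs 1)%coqR by apply: abs_gt0; apply: oner_neq0.
by apply: (Rmult_eq_reg_l (abs 1)); lra.
Qed.
Lemma absN1 : abs (-1) = 1%coqR.
Proof.
have := absM (-1) (-1); rewrite mulrNN mulr1 abs1 => e.
have p := abs_ge0 (-1).
have [//|h] : abs (-1) = 1%coqR \/ abs (-1) = (-1)%coqR by apply: Rsqr_eq; rewrite /Rsqr; lra.
by lra.
Qed.
Lemma absN x : abs (- x) = abs x.
Proof. by rewrite -mulN1r absM absN1; lra. Qed.
Lemma absX x n : abs (x ^+ n) = pow (abs x) n.
Proof. by elim: n => [|n ih]; rewrite ?abs1 // exprS absM ih. Qed.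
Lemma absV x : x != 0 -> abs x^-1 = (/ abs x)%coqR.
Proof.
move=> x0; have p := abs_gt0 x0; have := absM x x^-1.
by rewrite mulfV // abs1 => e; apply: (Rmult_eq_reg_l (abs x)); [rewrite Rinv_r -?e; lra|lra].
Qed.

Lemma absD_le x y C : (abs x <= C -> abs y <= C -> abs (x + y) <= C)%coqR.
Proof. by move=> h k; apply: Rle_trans (absD x y) _; apply: Rmax_lub. Qed.
Lemma absD_lt x y C : (abs x < C -> abs y < C -> abs (x + y) < C)%coqR.
Proof. by move=> h k; apply: Rle_lt_trans (absD x y) _; apply: Rmax_lub_lt. Qed.
Lemma absB_le x y C : (abs x <= C -> abs y <= C -> abs (x - y) <= C)%coqR.
Proof. by move=> h k; apply: absD_le; rewrite ?absN. Qed.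
Lemma absB_lt x y C : (abs x < C -> abs y < C -> abs (x - y) < C)%coqR.
Proof. by move=> h k; apply: absD_lt; rewrite ?absN. Qed.
Lemma abs_dom x y : (abs y < abs x)%coqR -> abs (x + y) = abs x.
Proof.
move=> h; apply: Rle_antisym; first by apply: absD_le; lra.
apply: Rnot_lt_le => k; have := absB_lt k h; rewrite addrK; lra.
Qed.

Lemma abs_sum_le (I : Type) (r : seq I) (P : pred I) (G : I -> F) C :
  (0 <= C)%coqR -> (forall i, P i -> (abs (G i) <= C)%coqR) ->
  (abs (\sum_(i <- r | P i) G i) <= C)%coqR.
Proof.
move=> C0 h; elim/big_ind: _ => //; first by rewrite abs0.
by move=> x y; apply: absD_le.
Qed.
Lemma abs_sum_lt (I : Type) (r : seq I) (P : pred I) (G : I -> F) C :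
  (0 < C)%coqR -> (forall i, P i -> (abs (G i) < C)%coqR) ->
  (abs (\sum_(i <- r | P i) G i) < C)%coqR.
Proof.
move=> C0 h; elim/big_ind: _ => //; first by rewrite abs0.
by move=> x y; apply: absD_lt.
Qed.

Section Conv.
Variable m : nat.
Implicit Types f g h : fps F m.

(* The coefficients tend to 0: convergence on the closed unit ball. *)
Definition inA f : Prop := forall eps, (0 < eps)%coqR ->
  exists N : nat, forall a, (N <= mdeg a)%N -> (abs (f a) < eps)%coqR.

Definition bnd f (C : R) : Prop := forall a, (abs (f a) <= C)%coqR.

(* Among the coefficients of largest absolute value, the one whose monomial is the
   largest for the degree-lexicographic order of [mpoly]. *)
Definition lead f a : Prop := f a != 0 /\
  forall b, (abs (f b) <= abs (f a))%coqR /\ ((a < b)%O -> (abs (f b) < abs (f a))%coqR).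

Lemma seq_argmax f (s : seq 'X_{1..m}) : s != [::] ->
  exists2 a, a \in s & forall b, b \in s ->
    (abs (f b) < abs (f a))%coqR \/ abs (f b) = abs (f a) /\ (b <= a)%O.
Proof.
elim: s => // c s ih _; have [->|s0] := eqVneq s [::].
  by exists c; rewrite ?inE // => b; rewrite inE => /eqP->; right.
have [a sa ha] := ih s0.
have [lt|[eq|gt]] := Rtotal_order (abs (f a)) (abs (f c)).
- exists c; rewrite ?inE ?eqxx // => b; rewrite inE => /orP[/eqP->|/ha]; first by right.
  by left; lra.
- have [ca|ac] := leP c a.
    exists a; rewrite ?inE ?sa ?orbT // => b; rewrite inE => /orP[/eqP->|/ha //].
    by right.
  exists c; rewrite ?inE ?eqxx // => b; rewrite inE => /orP[/eqP->|/ha]; first by right.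
  rewrite -eq => -[|[e ba]]; [by left | right; split=> //].
  exact: le_trans ba (ltW ac).
- exists a; rewrite ?inE ?sa ?orbT // => b; rewrite inE => /orP[/eqP->|/ha //].
  by left.
Qed.

(** All but finitely many coefficients are smaller than a fixed non-zero one, so the maximum is
    taken over a finite set of monomials. *)
Lemma lead_ex f : inA f -> f != 0 -> exists a, lead f a.
Proof.
move=> Af f0.
have [b fb] : exists b, f b != 0.
  apply: contrapT => h; case/eqP: f0; apply: fpsP => b; apply: contrapT => fb.
  by apply: h; exists b; apply/eqP.
have [N hN] := Af _ (abs_gt0 fb).
pose M := (maxn N (mdeg b)).+1.
pose s := map val (enum {: 'X_{1..m < M}}).
have ms c : (mdeg c < M)%N -> c \in s.
  by move=> h; apply/mapP; exists (BMultinom h); rewrite ?mem_enum.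
have bs : b \in s by apply: ms; rewrite ltnS leq_maxr.
have [|a sa ha] := @seq_argmax f s; first by apply/eqP => e; rewrite e in bs.
have ba : (abs (f b) <= abs (f a))%coqR by case: (ha _ bs) => [|[->]]; lra.
exists a; split.
  apply/eqP => /abs_eq0 e; have := abs_gt0 fb; lra.
move=> c; have [h|h] := ltnP (mdeg c) M.
  case: (ha _ (ms _ h)) => [|[-> ca]]; first by split; lra.
  by split; [lra | rewrite ltNge ca].
have := hN c (leq_trans (leq_maxl _ _) (ltnW h)).
by split; lra.
Qed.

Lemma lead_bnd f a : lead f a -> bnd f (abs (f a)).
Proof. by case=> _ h b; case: (h b). Qed.

Lemma bnd0 C : (0 <= C)%coqR -> bnd 0 C.
Proof. by move=> h a; rewrite coef_0 abs0. Qed.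

Lemma inA_bnd f : inA f -> exists2 C, (0 < C)%coqR & bnd f C.
Proof.
move=> Af; have [->|f0] := eqVneq f 0; first by exists 1%coqR; [lra | apply: bnd0; lra].
have [a la] := lead_ex Af f0; exists (abs (f a)); last exact: lead_bnd.
by apply: abs_gt0; case: la.
Qed.

Lemma bnd_le f C D : (C <= D)%coqR -> bnd f C -> bnd f D.
Proof. by move=> h k a; have := k a; lra. Qed.
Lemma bndD f g C : bnd f C -> bnd g C -> bnd (f + g) C.
Proof. by move=> h k a; apply: absD_le. Qed.
Lemma bndN f C : bnd f C -> bnd (- f) C.
Proof. by move=> h a; rewrite coef_opp absN. Qed.
Lemma bndB f g C : bnd f C -> bnd g C -> bnd (f - g) C.
Proof. by move=> h k; apply: bndD => //; apply: bndN. Qed.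
Lemma bnd_ge0 f C : bnd f C -> (0 <= C)%coqR.
Proof. by move=> h; apply: Rle_trans (abs_ge0 _) (h 0%MM). Qed.
Lemma bndM f g C D : bnd f C -> bnd g D -> bnd (f * g) (C * D)%coqR.
Proof.
move=> h k a; rewrite coef_mul; have C0 := bnd_ge0 h; have D0 := bnd_ge0 k.
apply: abs_sum_le => [|i _]; first by apply: Rmult_le_pos.
by rewrite absM; apply: Rmult_le_compat; auto using abs_ge0.
Qed.
Lemma bnd_eq0 f : (forall eps, (0 < eps)%coqR -> bnd f eps) -> f = 0.
Proof.
move=> h; apply: fpsP => a; apply/abs_eq0; apply: Rle_antisym (abs_ge0 _).
by apply: le_epsilon => e e0; rewrite Rplus_0_l; apply: h.
Qed.

Lemma inA0 : inA 0.
Proof. by move=> e e0; exists 0%N => a _; rewrite coef_0 abs0. Qed.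
Lemma inA_fpsX b : inA (fpsX F b).
Proof.
move=> e e0; exists (mdeg b).+1 => a ba /=.
by case: eqP => [E|_]; rewrite ?abs0 //; rewrite E ltnn in ba.
Qed.
Lemma inA1 : inA 1. Proof. exact: inA_fpsX. Qed.
Lemma inAN f : inA f -> inA (- f).
Proof. by move=> h e /h[N hN]; exists N => a /hN; rewrite coef_opp absN. Qed.
Lemma inAD f g : inA f -> inA g -> inA (f + g).
Proof.
move=> h k e e0; have [N hN] := h _ e0; have [M hM] := k _ e0.
exists (maxn N M) => a; rewrite geq_max => /andP[na ma].
by apply: absD_lt; [apply: hN | apply: hM].
Qed.
Lemma inAB f g : inA f -> inA g -> inA (f - g).
Proof. by move=> h k; apply: inAD => //; apply: inAN. Qed.
Lemma inAM f g : inA f -> inA g -> inA (f * g).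
Proof.
move=> h k e e0; have [C C0 hC] := inA_bnd h; have [D D0 hD] := inA_bnd k.
have [N hN] := h _ (Rdiv_lt_0_compat _ _ e0 D0).
have [M hM] := k _ (Rdiv_lt_0_compat _ _ e0 C0).
exists (N + M)%N => a na; rewrite coef_mul; apply: abs_sum_lt => // i /eqP E.
rewrite absM; have [lt|ge] := ltnP (mdeg (val i.1)) N; last first.
  have h1 := hN _ ge; have h2 := hD i.2; have h3 := abs_ge0 (f i.1).
  apply: (Rle_lt_trans _ (abs (f i.1) * D)); first by apply: Rmult_le_compat_l.
  have -> : e = (e / D * D)%coqR by real_field; lra.
  by apply: Rmult_lt_compat_r.
have ge : (M <= mdeg (val i.2))%N.
  have : (N + M <= mdeg (val i.1) + mdeg (val i.2))%N by rewrite -mdegD -E.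
  by move=> q; rewrite -(leq_add2l N); apply: (leq_trans q); rewrite leq_add2r ltnW.
have h1 := hM _ ge; have h2 := hC i.1; have h3 := abs_ge0 (g i.2).
apply: (Rle_lt_trans _ (C * abs (g i.2))); first by apply: Rmult_le_compat_r.
have -> : e = (C * (e / C))%coqR by real_field; lra.
by apply: Rmult_lt_compat_l.
Qed.

(** The Gauss norm is multiplicative: if c + d = a + b and (c, d) differs from (a, b), then c > a or
    d > b, so one term strictly dominates the coefficient of a + b. *)
Lemma leadM f g a b : lead f a -> lead g b -> lead (f * g) (a + b)%MM.
Proof.
case=> fa ha [gb hb]; have pa := abs_gt0 fa; have pb := abs_gt0 gb.
have pos : (0 < abs (f a) * abs (g b))%coqR by apply: Rmult_lt_0_compat.
have le c d : (abs (f c * g d) <= abs (f a) * abs (g b))%coqR.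
  rewrite absM; case: (ha c) (hb d) => h1 _ [h2 _].
  by apply: Rmult_le_compat => //; apply: abs_ge0.
have lt c d : (a < c)%O || (b < d)%O -> (abs (f c * g d) < abs (f a) * abs (g b))%coqR.
  rewrite absM; case: (ha c) (hb d) => h1 h1' [h2 h2'] /orP[/h1'|/h2'] h3.
    apply: (Rle_lt_trans _ (abs (f c) * abs (g b))).
      by apply: Rmult_le_compat_l => //; apply: abs_ge0.
    exact: Rmult_lt_compat_r.
  apply: (Rle_lt_trans _ (abs (f a) * abs (g d))).
    by apply: Rmult_le_compat_r => //; apply: abs_ge0.
  exact: Rmult_lt_compat_l.
have top : abs ((f * g) (a + b)%MM) = (abs (f a) * abs (g b))%coqR.
  rewrite (coef_mul_seq _ _ (below_uniq _) (@mem_below _ _)).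
  rewrite (bigD1_seq a) ?below_uniq ?mem_below ?inE ?lem_addr //=.
  have -> : (a + b - a = b)%MM by rewrite addmC addmK.
  rewrite abs_dom absM // big_seq_cond; apply: abs_sum_lt => // c.
  rewrite mem_below inE => /andP[ca nc]; apply: lt.
  rewrite -[_ || _]negbK negb_or -!leNgt; apply/negP => /andP[le1 le2].
  have lc : (c < a)%O by rewrite lt_neqAle nc.
  by have := ltmc_le_add lc le2; rewrite lem_addr_sub // ltxx.
split; first by apply/eqP => /abs_eq0; lra.
move=> c; rewrite top; split.
  by rewrite coef_mul; apply: abs_sum_le => //; lra.
move=> hc; rewrite coef_mul; apply: abs_sum_lt => // i /eqP E; apply: lt.
rewrite -[_ || _]negbK negb_or -!leNgt; apply/negP => /andP[le1 le2].
by have := lem_add le1 le2; rewrite -E leNgt hc.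
Qed.

Lemma lead_uniq f a b : lead f a -> lead f b -> a = b.
Proof.
case=> _ ha [_ hb]; case: (ltgtP a b) => // h.
  by case: (ha b) => _ /(_ h); case: (hb a); lra.
by case: (hb a) => _ /(_ h); case: (ha b); lra.
Qed.

Lemma inA_domain f g : inA f -> inA g -> f * g = 0 -> f = 0 \/ g = 0.
Proof.
move=> Af Ag fg; have [|f0] := eqVneq f 0; first by left.
have [|g0] := eqVneq g 0; first by right.
have [a la] := lead_ex Af f0; have [b lb] := lead_ex Ag g0.
by case: (leadM la lb); rewrite fg coef_0 eqxx.
Qed.

Lemma lead1 : lead 1 0%MM.
Proof.
split; first by rewrite coef_1 eqxx oner_eq0.
move=> b; rewrite !coef_1 eqxx; case: eqP => [<-|e]; first by rewrite ltxx; split=> //; apply: Rle_refl.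
by rewrite mulr1n mulr0n abs1 abs0; split=> *; lra.
Qed.

Lemma inA_scl r f : (abs r <= 1)%coqR -> inA f -> inA (scl r f).
Proof.
move=> r1 h e /h[N hN]; exists N => a /hN /=; rewrite absM absX => h1.
have h2 : (0 <= abs r ^ mdeg a <= 1)%coqR.
  split; first by apply: pow_le; apply: abs_ge0.
  rewrite -(pow1 (mdeg a)); apply: pow_incr; split=> //; exact: abs_ge0.
have := abs_ge0 (f a); nra.
Qed.

End Conv.

Arguments inA {m} f.
Arguments bnd {m} f C.
Arguments lead {m} f a.

Lemma inA_ext m (f : fps F m) : inA f -> inA (ext f).
Proof.
move=> h e e0; have [N hN] := h e e0; exists N => a; rewrite coef_ext.
case: eqP => [a0|]; last by rewrite abs0.
by rewrite -{1}(cons_tail a) a0 mdeg_cons add0n => /hN.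
Qed.
End Nonarch.

Arguments inA {F} abs {m} f.
Arguments bnd {F} abs {m} f C.
Arguments lead {F} abs {m} f a.

(** * Weierstrass division *)

Section Weierstrass.
Variables (F : fieldType) (abs : F -> R) (habs : is_nonarch_abs abs).
Hypothesis hcomp : abs_complete abs.
Local Notation inA := (inA abs).
Local Notation bnd := (bnd abs).
Local Notation lead := (lead abs).

(** Limits are taken coefficientwise; the bounds [e n] are uniform in the monomial, so they pass to
    the limit and carry convergence with them. *)
Lemma fps_complete m (V : nat -> fps F m) (e : nat -> R) :
  (forall n, inA (V n)) ->
  (forall eps, (0 < eps)%coqR -> exists n, (e n < eps)%coqR) ->
  (forall n k, (n <= k)%N -> bnd (V k - V n) (e n)) ->
  exists U, inA U /\ forall n, bnd (U - V n) (e n).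
Proof.
move=> AV e0 hV.
have [u hu] : {u : _ -> F & forall a eps, (0 < eps)%coqR -> exists N, forall n,
    (N <= n)%N -> (abs (V n a - u a) < eps)%coqR}.
  apply: (@choice _ _ (fun a l => forall eps, (0 < eps)%coqR -> exists N, forall n,
    (N <= n)%N -> (abs (V n a - l) < eps)%coqR)) => a.
  apply: hcomp => eps /e0[N hN]; exists N => p q Np Nq.
  have -> : V p a - V q a = (V p - V N) a - (V q - V N) a.
    by rewrite !coef_add !coef_opp opprB addrA subrK.
  by apply: Rle_lt_trans hN; apply: absB_le => //; apply: hV.
pose U := Fps u; have bU n : bnd (U - V n) (e n).
  move=> a; apply: le_epsilon => eps eps0; have [N hN] := hu a _ eps0.
  pose k := maxn N n.
  have -> : (U - V n) a = (V k - V n) a - (V k a - u a).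
    by rewrite !coef_add !coef_opp /= opprB addrCA addrAC subrr add0r.
  have := hV n k (leq_maxr _ _) a; have := hN k (leq_maxl _ _).
  have := abs_ge0 habs ((V k - V n) a).
  by move=> h1 h2 h3; apply: absB_le => //; lra.
exists U; split=> // eps eps0; have [n hn] := e0 _ eps0.
have [N hN] := AV n _ eps0; exists N => a Na.
have -> : U a = (U - V n) a + V n a by rewrite coef_add coef_opp subrK.
by apply: absD_lt; [exact: habs | have := bU n a; lra | exact: hN].
Qed.

Section Division.
Variable m : nat.
Implicit Types f g q s : fps F m.+1.

Definition zdeg_lt d f : Prop := forall a : 'X_{1..m.+1}, (d <= a ord0)%N -> f a = 0.

Lemma zdeg_ltD d f g : zdeg_lt d f -> zdeg_lt d g -> zdeg_lt d (f + g).
Proof. by move=> h k a da; rewrite coef_add h ?k ?addr0. Qed.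
Lemma zdeg_ltN d f : zdeg_lt d f -> zdeg_lt d (- f).
Proof. by move=> h a da; rewrite coef_opp h ?oppr0. Qed.
Lemma zdeg_ltM d e f g : zdeg_lt d.+1 f -> zdeg_lt e g -> zdeg_lt (d + e) (f * g).
Proof.
move=> h k a; rewrite coef_mul => da; apply: big1 => i.
move=> /eqP /(congr1 (fun b : 'X_{1..m.+1} => b ord0)) E.
rewrite E mnmDE in da; have [lt|ge] := leqP d.+1 (val i.1 ord0).
  by rewrite h ?mul0r.
rewrite k ?mulr0 // -(leq_add2l d); apply: leq_trans da _.
by rewrite leq_add2r -ltnS.
Qed.

(* The main variable is the one of index 0, the largest of degree 1 for the monomial
   order: [lead f (dX d)] says that f is distinguished of degree d in that variable. *)
Local Notation dX d := (U_(ord0) *+ d : 'X_{1..m.+1})%MM.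

Lemma dX0 d : (dX d) ord0 = d. Proof. by rewrite mulmnE mnm1E eqxx mul1n. Qed.
Lemma mdeg_dX d : mdeg (dX d) = d. Proof. by rewrite mdegMn mdeg1 mul1n. Qed.
Lemma dX_uniq d (a : 'X_{1..m.+1}) : (mdeg a <= d)%N -> (d <= a ord0)%N -> a = dX d.
Proof.
have := mdeg_cons (a ord0) (tailm a); rewrite cons_tail => -> h k.
have a0 : a ord0 = d by apply/eqP; rewrite eqn_leq k (leq_trans (leq_addr _ _) h).
have t0 : tailm a = 0%MM.
  by apply/eqP; rewrite -mdeg_eq0 -leqn0 -(leq_add2l d) addn0 -{1}a0.
rewrite -(cons_tail a) t0 a0; apply/mnmP => i; rewrite mulmnE mnm1E mnmE.
by case: unliftP => [j ->|->]; rewrite ?mnm0E ?eqxx ?mul1n //.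
Qed.
Lemma dX_le d (a : 'X_{1..m.+1}) : (dX d <= a)%MM = (d <= a ord0)%N.
Proof.
apply/mnm_lepP/idP => [/(_ ord0)|h j]; first by rewrite dX0.
by rewrite mulmnE mnm1E; case: eqP => [<-|_]; rewrite ?mul1n.
Qed.

(** If q were non-zero, the leading monomial of q f would be that of q times X^d, of main degree at
    least d. *)
Lemma wdiv_uniq d f q : inA f -> lead f (dX d) -> inA q -> zdeg_lt d (q * f) -> q = 0.
Proof.
move=> Af lf Aq z; apply: contrapT => /eqP q0; have [a la] := lead_ex habs Aq q0.
have [] := leadM habs la lf; rewrite z ?eqxx // mnmDE dX0; exact: leq_addl.
Qed.

Lemma inA_sub f g : (forall a, f a = g a \/ f a = 0) -> inA g -> inA f.
Proof.
move=> h Ag e e0; have [N hN] := Ag _ e0; exists N => a /hN.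
by case: (h a) => ->; rewrite ?(abs0 habs).
Qed.
Lemma bnd_sub f g C : (forall a, f a = g a \/ f a = 0) -> bnd g C -> bnd f C.
Proof.
move=> h k a; have := k a; case: (h a) => -> //; rewrite (abs0 habs) => _.
exact: bnd_ge0 k.
Qed.

Section Existence.
Variables (d : nat) (f : fps F m.+1).
Hypotheses (Af : inA f) (lf : lead f (dX d)).
Let c := f (dX d).
Let c0 : c != 0. Proof. by case: lf. Qed.
Let pc : (0 < abs c)%coqR. Proof. exact: abs_gt0. Qed.

(* P has total degree d, hence leading coefficient c in the main variable. *)
Let P := Fps (fun a => if (mdeg a <= d)%N then f a else 0).

Lemma inA_head : inA P.
Proof. by apply: (inA_sub _ Af) => a /=; case: ifP; [left | right]. Qed.
Lemma bnd_head : bnd P (abs c).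
Proof.
by apply: (@bnd_sub _ f) (lead_bnd lf) => a /=; case: ifP; [left | right].
Qed.

(** Since X^d is the largest monomial with a coefficient of maximal size, every coefficient of
    degree above d is smaller than |c|. The tail attains its maximum, which gives a uniform ratio
    below 1. *)
Lemma tail_bound : exists theta, (0 < theta < 1)%coqR /\ bnd (f - P) (theta * abs c)%coqR.
Proof.
have AE : inA (f - P) by apply: inAB => //; apply: inA_head.
have E a : (f - P) a = if (mdeg a <= d)%N then 0 else f a.
  by rewrite coef_add coef_opp /=; case: ifP; rewrite ?subrr ?subr0.
have [->|E0] := eqVneq (f - P) 0.
  by exists (1/2)%coqR; split; [lra | apply: bnd0 => //; lra].
have [a la] := lead_ex habs AE E0; have lt : (abs ((f - P) a) < abs c)%coqR.
  rewrite E; case: ifP => [|/negbT]; rewrite ?(abs0 habs) // -ltnNge => da.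
  by apply: (proj2 (proj2 lf a)); apply: lt_mdeg_ltmc; rewrite mdeg_dX.
exists (abs ((f - P) a) / abs c)%coqR; split.
  case: la => h _; have h' := abs_gt0 habs h; split; first exact: Rdiv_lt_0_compat.
  by apply: (Rmult_lt_reg_r (abs c)) => //; field_simplify; lra.
have -> : (abs ((f - P) a) / abs c * abs c)%coqR = abs ((f - P) a) by real_field; lra.
exact: lead_bnd.
Qed.

(** Long division by P, whose leading coefficient c is also its norm; hence no step increases the
    bound on the dividend. *)
Lemma div_head n : forall g C, inA g -> bnd g C -> zdeg_lt (n + d) g ->
  exists q s, [/\ inA q, inA s, bnd q (C / abs c)%coqR, bnd s C &
     zdeg_lt d s /\ g = q * P + s].
Proof.
elim: n => [|n ih] g C Ag bg zg.
  exists 0, g; split=> //; [exact: inA0 | | by rewrite mul0r add0r].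
  by apply: bnd0 => //; have := bnd_ge0 habs bg; move=> C0; apply: Rle_mult_inv_pos.
(* The quotient that cancels the part of g of main degree n + d. *)
pose q1 := Fps (fun a : 'X_{1..m.+1} =>
  if a ord0 == n then c^-1 * g (a + dX d)%MM else 0).
have Aq1 : inA q1.
  move=> e e0; have [N hN] := Ag _ (Rmult_lt_0_compat _ _ e0 pc); exists N => a Na /=.
  case: eqP => _; rewrite ?(abs0 habs) // (absM habs) (absV habs) //.
  have h := hN (a + dX d)%MM; rewrite mdegD in h.
  have {}h := h (leq_trans Na (leq_addr _ _)).
  by apply: (Rmult_lt_reg_l (abs c)) => //; field_simplify; lra.
have bq1 : bnd q1 (C / abs c)%coqR.
  move=> a /=; have C0 := bnd_ge0 habs bg.
  case: eqP => _; last by rewrite (abs0 habs); apply: Rle_mult_inv_pos.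
  rewrite (absM habs) (absV habs) // Rmult_comm /Rdiv.
  by apply: Rmult_le_compat_r; [apply: Rlt_le; apply: Rinv_0_lt_compat | apply: bg].
(* Total degree at most d leaves c X^d as the only term of P of main degree d. *)
pose L := P - cst m.+1 c * fpsX F (dX d).
have zL : zdeg_lt d L.
  move=> a da; rewrite coef_add coef_opp coef_cst /=.
  case: (ifP (mdeg a <= d)%N) => [ad|nad].
    by rewrite (dX_uniq ad da) eqxx mulr1 subrr.
  case: eqP => [E|_]; last by rewrite mulr0 subrr.
  by move: nad; rewrite -E mdeg_dX leqnn.
have PL : P = cst m.+1 c * fpsX F (dX d) + L by rewrite addrC subrK.
have zq1 : zdeg_lt n.+1 q1.
  by move=> a na /=; case: eqP => // E; rewrite E ltnn in na.
have zg' : zdeg_lt (n + d) (g - q1 * P).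
  rewrite PL mulrDr opprD addrA; apply: zdeg_ltD; last first.
    by apply/zdeg_ltN/zdeg_ltM.
  move=> a na; rewrite coef_add coef_opp mulrCA coef_cst coef_mulX dX_le.
  rewrite (leq_trans (leq_addl _ _) na) /= mnmBE dX0.
  case: eqP => [E|E]; last first.
    rewrite mulr0 subr0 zg // addSn ltn_neqAle na andbT; apply/eqP => E'.
    by apply: E; rewrite -E' addnK.
  rewrite submK ?mulVKf ?subrr //.
  by rewrite dX_le (leq_trans (leq_addl _ _) na).
have Ag' : inA (g - q1 * P) by apply: inAB => //; apply: inAM => //; apply: inA_head.
have bg' : bnd (g - q1 * P) C.
  apply: bndB => //; have -> : C = (C / abs c * abs c)%coqR by real_field; lra.
  by apply: bndM => //; apply: bnd_head.
have [q [s [Aq As bq bs [zs E]]]] := ih _ _ Ag' bg' zg'.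
exists (q1 + q), s; split=> //; [exact: inAD | exact: bndD |split=> //].
by rewrite mulrDl -addrA -E addrC subrK.
Qed.

(** Division by f up to an error smaller by the factor theta. The pair is chosen before C, so that
    iterating it is a function of g alone. *)
Lemma div_step : exists theta, (0 < theta < 1)%coqR /\ forall g, inA g ->
  exists qs : fps F m.+1 * fps F m.+1, [/\ inA qs.1, inA qs.2, zdeg_lt d qs.2 &
    forall C, bnd g C -> [/\ bnd qs.1 (C / abs c)%coqR, bnd qs.2 C &
       bnd (g - (qs.1 * f + qs.2)) (theta * C)%coqR]].
Proof.
have [th [[th0 th1] bE]] := tail_bound; exists th; split=> // g Ag.
have [g0|gn0] := eqVneq g 0.
  exists (0, 0); split=> //=; try exact: inA0.
  move=> C; rewrite g0 => /(bnd_ge0 habs) C0; rewrite mul0r addr0 subr0.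
  split; apply: bnd0 => //; first exact: Rle_mult_inv_pos.
  by apply: Rmult_le_pos; lra.
have [a la] := lead_ex habs Ag gn0; have pa := abs_gt0 habs (proj1 la).
have [N hN] := Ag _ (Rmult_lt_0_compat _ _ th0 pa).
(* The discarded coefficients have degree at least N, hence size at most theta times the norm of g;
   what remains is polynomial in the main variable. *)
pose g1 := Fps (fun b : 'X_{1..m.+1} => if (b ord0 < N + d)%N then g b else 0).
have sub1 b : g1 b = g b \/ g1 b = 0 by rewrite /=; case: ifP; [left | right].
have bg1 : bnd g1 (abs (g a)) by apply: bnd_sub (lead_bnd la).
have Ag1 : inA g1 by apply: inA_sub Ag.
have z1 : zdeg_lt (N + d) g1 by move=> b h /=; rewrite ltnNge h.
have br : bnd (g - g1) (th * abs (g a))%coqR.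
  move=> b; rewrite coef_add coef_opp /=; case: ltnP => h.
    by rewrite subrr (abs0 habs); apply: Rmult_le_pos; lra.
  rewrite subr0; apply: Rlt_le; apply: hN; apply: leq_trans (leq_trans (leq_addr _ _) h) _.
  by rewrite -(cons_tail b) mdeg_cons consm0 leq_addr.
have [q [s [Aq As bq bs [zs E]]]] := div_head Ag1 bg1 z1.
(* The norm |g a| is attained, so it lies below every bound C. *)
exists (q, s); split=> //= C /(_ a) hC; split.
- apply: bnd_le bq; apply: Rmult_le_compat_r => //.
  by apply: Rlt_le; apply: Rinv_0_lt_compat.
- exact: bnd_le bs.
apply: (@bnd_le _ _ _ _ (th * abs (g a))%coqR); first by apply: Rmult_le_compat_l; lra.
(* The error is the tail of g and q times the tail of f, each at most theta times the norm of g. *)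
have -> : g - (q * f + s) = (g - g1) - q * (f - P).
  by rewrite E; ring.
apply: bndB => //.
have -> : (th * abs (g a))%coqR = (abs (g a) / abs c * (th * abs c))%coqR by real_field; lra.
exact: bndM.
Qed.

(** Iterating [div_step] on the errors gives geometrically decreasing quotients and remainders,
    whose sums converge. *)
Theorem wdiv g : inA g -> exists q s, [/\ inA q, inA s, zdeg_lt d s & g = q * f + s].
Proof.
(* Choice needs a step for every series; a divergent one gets the dummy value (0, 0). *)
have [th [[th0 th1] hstep]] := div_step => Ag.
have [st hst] : {st : fps F m.+1 -> fps F m.+1 * fps F m.+1 & forall g, inA g ->
  [/\ inA (st g).1, inA (st g).2, zdeg_lt d (st g).2 &
    forall C, bnd g C -> [/\ bnd (st g).1 (C / abs c)%coqR, bnd (st g).2 C &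
       bnd (g - ((st g).1 * f + (st g).2)) (th * C)%coqR]]}.
  apply: (@choice _ _ (fun g qs => inA g -> [/\ inA qs.1, inA qs.2, zdeg_lt d qs.2 &
    forall C, bnd g C -> [/\ bnd qs.1 (C / abs c)%coqR, bnd qs.2 C &
       bnd (g - (qs.1 * f + qs.2)) (th * C)%coqR]])) => h.
  have [/hstep[qs ?]|nA] := pselect (inA h); first by exists qs.
  by exists (0, 0).
have [C C0 bg] := inA_bnd habs Ag.
pose G n := iter n (fun h => h - ((st h).1 * f + (st h).2)) g.
have AG n : inA (G n).
  elim: n => //= n ih; have [h1 h2 _ _] := hst _ ih.
  by apply: inAB => //; apply: inAD => //; apply: inAM.
have bG n : bnd (G n) (C * th ^ n)%coqR.
  elim: n => [|n ih]; first by rewrite Rmult_1_r.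
  have [_ _ _ /(_ _ ih)[_ _]] := hst _ (AG n).
  by rewrite /= (_ : (th * (C * _)) = C * (th * th ^ n))%coqR //; lra.
pose Q n := \sum_(i < n) (st (G i)).1; pose S n := \sum_(i < n) (st (G i)).2.
have QS n : Q n.+1 = Q n + (st (G n)).1 by rewrite /Q big_ord_recr.
have SS n : S n.+1 = S n + (st (G n)).2 by rewrite /S big_ord_recr.
have Q0 : Q 0%N = 0 by rewrite /Q big_ord0.
have S0 : S 0%N = 0 by rewrite /S big_ord0.
have gE n : g = Q n * f + S n + G n.
  elim: n => [|n ih]; first by rewrite Q0 S0 mul0r !add0r.
  by rewrite {1}ih QS SS [G n.+1]/= -/(G n); ring.
have AQ n : inA (Q n).
  elim: n => [|n ih]; rewrite ?Q0 ?QS; first exact: inA0.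
  by apply: inAD => //; case: (hst _ (AG n)).
have AS n : inA (S n).
  elim: n => [|n ih]; rewrite ?S0 ?SS; first exact: inA0.
  by apply: inAD => //; case: (hst _ (AG n)).
have zS n : zdeg_lt d (S n).
  elim: n => [|n ih]; rewrite ?S0 ?SS //.
  by apply: zdeg_ltD => //; case: (hst _ (AG n)).
have thn n : (0 < th ^ n)%coqR by apply: pow_lt.
have mono n k : (n <= k)%N -> (C * th ^ k <= C * th ^ n)%coqR.
  move=> /subnK <-; elim: (k - n)%N => [|j ih]; first exact: Rle_refl.
  apply: Rle_trans ih; apply: Rmult_le_compat_l; first lra.
  by rewrite addSn /=; have := thn (j + n)%N; nra.
have cQ n k : (n <= k)%N -> bnd (Q k - Q n) (C * th ^ n / abs c)%coqR.
  move=> /subnK <-; elim: (k - n)%N => [|j ih].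
    rewrite subrr; apply: bnd0 => //; apply: Rle_mult_inv_pos => //.
    by have := thn n; nra.
  rewrite addSn QS addrAC; apply: bndD => //.
  have [_ _ _ /(_ _ (bG _))[h _ _]] := hst _ (AG (j + n)%N).
  apply: bnd_le h; apply: Rmult_le_compat_r; last by apply: mono; apply: leq_addl.
  by apply: Rlt_le; apply: Rinv_0_lt_compat.
have cS n k : (n <= k)%N -> bnd (S k - S n) (C * th ^ n)%coqR.
  move=> /subnK <-; elim: (k - n)%N => [|j ih].
    by rewrite subrr; apply: bnd0 => //; have := thn n; nra.
  rewrite addSn SS addrAC; apply: bndD => //.
  have [_ _ _ /(_ _ (bG _))[_ h _]] := hst _ (AG (j + n)%N).
  by apply: bnd_le h; apply: mono; apply: leq_addl.
have lim eps : (0 < eps)%coqR -> exists n, (C * th ^ n < eps)%coqR.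
  move=> e0; have [|N hN] := pow_lt_1_zero th _ (eps / C) (Rdiv_lt_0_compat _ _ e0 C0).
    by rewrite Rabs_pos_eq; lra.
  exists N; have := hN N (le_n N); rewrite Rabs_pos_eq; last exact: Rlt_le.
  move=> h; have -> : eps = (C * (eps / C))%coqR by real_field; lra.
  exact: Rmult_lt_compat_l.
have [Qi [AQi hQi]] : exists U, inA U /\ forall n, bnd (U - Q n) (C * th ^ n / abs c)%coqR.
  apply: fps_complete => // eps e0.
  have [n hn] := lim _ (Rmult_lt_0_compat _ _ e0 pc); exists n.
  by apply: (Rmult_lt_reg_r (abs c)) => //; rewrite /Rdiv Rmult_assoc Rinv_l; lra.
have [Si [ASi hSi]] : exists U, inA U /\ forall n, bnd (U - S n) (C * th ^ n)%coqR.
  exact: fps_complete.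
exists Qi, Si; split=> //.
  move=> a da; apply/(abs_eq0 habs); apply: Rle_antisym; last exact: abs_ge0.
  apply: le_epsilon => eps /lim[n hn]; have := hSi n a.
  by rewrite coef_add coef_opp (zS n) // subr0; lra.
apply/eqP; rewrite -subr_eq0; apply/eqP/(bnd_eq0 habs) => eps /lim[n hn].
have -> : g - (Qi * f + Si) = G n - ((Qi - Q n) * f + (Si - S n)).
  by rewrite {1}(gE n); ring.
apply: (@bnd_le _ _ _ _ (C * th ^ n)%coqR); first lra.
apply: bndB => //; apply: bndD => //.
have -> : (C * th ^ n)%coqR = (C * th ^ n / abs c * abs c)%coqR by real_field; lra.
by apply: bndM => //; apply: lead_bnd.
Qed.
End Existence.

End Division.

Lemma inA_cst m c : inA (cst m c).
Proof.
move=> e e0; exists 1%N => a /=; case: eqP => [->|_]; first by rewrite mdeg0.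
by rewrite (abs0 habs).
Qed.

(** Weierstrass division of 1 by u, distinguished of degree 0, leaves remainder 0. Without variables
    there is no main one, and u is a non-zero constant. *)
Lemma lead0_unit m (u : fps F m) : inA u -> lead u 0%MM -> exists2 v, inA v & u * v = 1.
Proof.
case: m u => [|m] u Au lu.
  have u0 : u 0%MM != 0 by case: lu.
  exists (cst 0 (u 0%MM)^-1); first exact: inA_cst.
  apply: fpsP => a; rewrite mulrC coef_cst coef_1 [a]nvar0_mnmE // eqxx.
  by rewrite mulVf.
have lu' : lead u (U_(ord0) *+ 0)%MM by rewrite mulm0n.
have [q [s [Aq As zs E]]] := wdiv Au lu' (inA1 habs m.+1).
by exists q => //; rewrite E mulrC (_ : s = 0) ?addr0 //; apply: fpsP => a; apply: zs.
Qed.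

Lemma unit_lead0 m (u v : fps F m) : inA u -> inA v -> u * v = 1 -> lead u 0%MM.
Proof.
move=> Au Av uv; have u0 : u != 0.
  by apply/eqP => u0; move: uv (oner_neq0 (fps F m)); rewrite u0 mul0r => <-; rewrite eqxx.
have v0 : v != 0.
  by apply/eqP => v0; move: uv (oner_neq0 (fps F m)); rewrite v0 mulr0 => <-; rewrite eqxx.
have [a la] := lead_ex habs Au u0; have [b lb] := lead_ex habs Av v0.
have := leadM habs la lb; rewrite uv => /(lead_uniq (lead1 habs m)) /esym/eqP.
by rewrite mnmD_eq0 => /andP[/eqP<-].
Qed.

End Weierstrass.

(** * Generic linear changes of variables *)

Section GenericPoint.
Variables (F : closedFieldType) (abs : F -> R) (habs : is_nonarch_abs abs).

(** Meant for roots a: at t, the value of X - a is at least as large as its coefficients 1 and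
    -a. *)
Lemma far_point (s : seq F) : exists t, (abs t <= 1)%coqR /\
  forall a, a \in s -> (Rmax 1 (abs a) <= abs (t - a))%coqR.
Proof.
pose s0 := [seq a <- s | `[< (abs a <= 1)%coqR >]].
(* A solution of \prod (t - a) = 1 over the a with |a| <= 1 is at distance 1 from each. *)
pose p := \prod_(a <- 0 :: s0) ('X - a%:P) - 1 : {poly F}.
have sp : size p != 1%N.
  have sz : size (\prod_(a <- 0 :: s0) ('X - a%:P)) = (size s0).+2.
    exact: (size_prod_XsubC _ id).
  by rewrite /p size_polyDl sz // size_polyN size_poly1.
have [t] := closed_rootP p sp; rewrite rootE /p hornerD hornerN hornerC horner_prod.
rewrite subr_eq0 => /eqP.
rewrite (eq_bigr (fun a => t - a)) => [E|a _]; last by rewrite hornerXsubC.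
have s1 a : a \in 0 :: s0 -> (abs a <= 1)%coqR.
  rewrite inE => /orP[/eqP->|]; first by rewrite (abs0 habs); lra.
  by rewrite mem_filter => /andP[/asboolP].
have t1 : (abs t <= 1)%coqR.
  apply: Rnot_lt_le => h.
  have ge r : {subset r <= 0 :: s0} -> (1 <= abs (\prod_(a <- r) (t - a)))%coqR.
    elim: r => [|a r ih] sub; first by rewrite big_nil (abs1 habs); lra.
    rewrite big_cons (absM habs) (abs_dom habs); last first.
      by rewrite (absN habs); have := s1 _ (sub a (mem_head _ _)); lra.
    have := ih (fun x xr => sub x (mem_behead (s := a :: r) xr)); nra.
  (* If |t| > 1, the factor t - 0 exceeds 1 and the others are at least 1, so the product cannot be
     1. *)
  have R1 x y : (1 < x -> 1 <= y -> x * y <> 1)%coqR by nra.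
  have := congr1 abs E; rewrite big_cons subr0 (absM habs) (abs1 habs).
  by apply: R1 => //; apply: (ge s0) => x xs; rewrite inE xs orbT.
exists t; split=> // a sa.
have [a1|a1] := Rle_lt_dec (abs a) 1.
  rewrite Rmax_left //.
  have as0 : a \in 0 :: s0 by rewrite inE mem_filter sa andbT; apply/orP; right; apply/asboolP.
  have le r : {subset r <= 0 :: s0} -> (abs (\prod_(a <- r) (t - a)) <= 1)%coqR.
    elim: r => [|b r ih] sub; first by rewrite big_nil (abs1 habs); lra.
    rewrite big_cons (absM habs).
    have h1 := ih (fun x xr => sub x (mem_behead (s := b :: r) xr)).
    have h2 : (abs (t - b) <= 1)%coqR.
      by apply: absB_le => //; apply: s1; apply: sub; apply: mem_head.
    have := abs_ge0 habs (t - b); have := abs_ge0 habs (\prod_(j <- r) (t - j)); nra.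
  (* All factors are at most 1 and their product is 1, so none is below 1. *)
  have R2 x y : (0 <= x -> y <= 1 -> x * y = 1 -> 1 <= x)%coqR by nra.
  have := congr1 abs E; rewrite (big_rem a) // (absM habs) (abs1 habs).
  by apply: R2; [exact: abs_ge0 | apply: le => x; apply: mem_rem].
rewrite Rmax_right; last lra.
rewrite -(absN habs (t - a)) opprB (abs_dom habs); first lra.
by rewrite (absN habs); lra.
Qed.

(** Induction on the linear factors: multiplying by X - a scales the value at t by |t - a| and the
    largest coefficient by no more than that. *)
Lemma poly_generic (p q : {poly F}) : p != 0 -> q != 0 ->
  exists t, [/\ (abs t <= 1)%coqR, forall i, (abs p`_i <= abs p.[t])%coqR &
    forall i, (abs q`_i <= abs q.[t])%coqR].
Proof.
move=> p0 q0.
have [r hr] := closed_field_poly_normal p; have [r' hr'] := closed_field_poly_normal q.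
have [t [t1 ht]] := far_point (r ++ r').
have key c s : {subset s <= r ++ r'} -> forall i,
    (abs (c *: \prod_(z <- s) ('X - z%:P))`_i <=
     abs (c *: \prod_(z <- s) ('X - z%:P)).[t])%coqR.
  elim: s => [|a s ih] sub i.
    rewrite big_nil coefZ hornerZ coef1 hornerC; case: eqP => _ /=; first exact: Rle_refl.
    by rewrite mulr0n mulr0 (abs0 habs); apply: abs_ge0.
  rewrite big_cons scalerAr hornerM hornerXsubC (absM habs) mulrBl coefB coefXM coefCM.
  have {}ih := ih (fun x xs => sub x (mem_behead (s := a :: s) xs)).
  set Q := c *: _ in ih *.
  have h := ht a (sub a (mem_head _ _)).
  have h1 := Rle_trans _ _ _ (Rmax_l _ _) h; have ha := Rle_trans _ _ _ (Rmax_r _ _) h.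
  have Q0 := abs_ge0 habs Q.[t].
  apply: absB_le => //.
    case: eqP => _; first by rewrite (abs0 habs); apply: Rmult_le_pos => //; apply: abs_ge0.
    apply: Rle_trans (ih i.-1) _; rewrite -{1}[abs Q.[t]]Rmult_1_l.
    exact: Rmult_le_compat_r.
  rewrite (absM habs); have := ih i; have := abs_ge0 habs a; have := abs_ge0 habs Q`_i.
  by move=> *; apply: Rmult_le_compat.
exists t; split=> // i; [rewrite hr | rewrite hr']; apply: key => x xr.
  by rewrite mem_cat xr.
by rewrite mem_cat xr orbT.
Qed.
End GenericPoint.

(** Makes the Kronecker substitution below injective; reduction modulo B recovers the lowest
    digit. *)
Lemma digits_inj B n (b b' : 'I_n -> nat) :
  (forall i, b i < B)%N -> (forall i, b' i < B)%N ->
  (\sum_i b i * B ^ i = \sum_i b' i * B ^ i)%N -> b =1 b'.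
Proof.
elim: n b b' => [|n ih] b b' h h'; first by move=> _ [].
rewrite !big_ord_recl !expn0 !muln1.
have E (c : 'I_n.+1 -> nat) : (\sum_(i < n) c (lift ord0 i) * B ^ lift ord0 i =
    (\sum_(i < n) c (lift ord0 i) * B ^ i) * B)%N.
  by rewrite big_distrl; apply: eq_bigr => i _; rewrite /= /bump add1n expnSr mulnA.
rewrite !E => e; have B0 : (0 < B)%N := leq_ltn_trans (leq0n _) (h ord0).
have e0 : b ord0 = b' ord0.
  by move/(congr1 (modn^~ B)): e; rewrite addnC modnMDl addnC modnMDl !modn_small.
have es : (fun i => b (lift ord0 i)) =1 (fun i => b' (lift ord0 i)).
  apply: ih => //.
  by move/eqP: e; rewrite e0 eqn_add2l eqn_pmul2r // => /eqP.
by move=> i; case: (unliftP ord0 i) => [j ->|->].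
Qed.

Lemma Rmult_le1 x y : (0 <= x -> x <= 1 -> 0 <= y -> y <= 1 -> x * y <= 1)%coqR.
Proof. by nra. Qed.

(** * Substitution of homogeneous linear forms *)

Section LinearSubstitution.
Variables (F : fieldType) (abs : F -> R) (habs : is_nonarch_abs abs).

Section Subst.
Variables (m : nat) (lq : m.-tuple {mpoly F[m]}).
Hypothesis hq : forall i, tnth lq i \is 1.-homog.
Implicit Types f g : fps F m.

Lemma comp_mpolyX_homog (b : 'X_{1..m}) : 'X_[b] \mPo lq \is (mdeg b).-homog.
Proof.
rewrite comp_mpolyX mdegE; elim/big_rec2: _ => [|i x e _ h]; first exact: dhomog1.
by apply: dhomogM => //; have := dhomogMn (b i) (hq i); rewrite mul1n.
Qed.

Lemma comp_mpoly_deg (p q : {mpoly F[m]}) a :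
  (forall b, mdeg b = mdeg a -> p@_b = q@_b) -> (p \mPo lq)@_a = (q \mPo lq)@_a.
Proof.
move=> h; apply/eqP; rewrite -subr_eq0 -mcoeffB -comp_mpolyB; apply/eqP.
rewrite comp_mpolyEX raddf_sum /= big1 // => b _; rewrite mcoeffZ.
have [e|ne] := eqVneq (mdeg b) (mdeg a); first by rewrite mcoeffB h // subrr mul0r.
by rewrite (dhomog_nemf_coeff (comp_mpolyX_homog b)) ?mulr0 // eq_sym.
Qed.

(** Linear forms preserve degree, so truncating at the degree of a already yields the right
    coefficient of a. *)
Definition fsub f : fps F m := Fps (fun a => (trunc (mdeg a) f \mPo lq)@_a).

Lemma fsubE n f a : (mdeg a <= n)%N -> fsub f a = (trunc n f \mPo lq)@_a.
Proof. by move=> an; apply: comp_mpoly_deg => b e; rewrite !truncE e leqnn an. Qed.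

Lemma fsubM f g : fsub (f * g) = fsub f * fsub g.
Proof.
apply: fpsP => a; rewrite (coef_mul_trunc _ _ (leqnn _)).
have h b f' : (mdeg b <= mdeg a)%N ->
    (trunc (mdeg a) (fsub f'))@_b = (trunc (mdeg a) f' \mPo lq)@_b.
  by move=> ba; rewrite truncE ba (fsubE _ ba).
rewrite (@mcoeffM_low _ _ (mdeg a) _ (trunc (mdeg a) f \mPo lq) _ (trunc (mdeg a) g \mPo lq)) //;
  try by move=> b; apply: h.
rewrite -rmorphM; apply: comp_mpoly_deg => b e.
by apply: trunc_mul; rewrite e.
Qed.

Lemma fsub_scl r f : fsub (scl r f) = scl r (fsub f).
Proof.
apply: fpsP => a; rewrite coef_scl mulrC -mcoeffZ -comp_mpolyZ.
by apply: comp_mpoly_deg => b e; rewrite mcoeffZ !truncE e leqnn coef_scl e mulrC.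
Qed.

Hypothesis bq : forall i a, (abs (tnth lq i)@_a <= 1)%coqR.

Lemma mbndM (p q : {mpoly F[m]}) : (forall a, (abs p@_a <= 1)%coqR) ->
  (forall a, (abs q@_a <= 1)%coqR) -> forall a, (abs (p * q)@_a <= 1)%coqR.
Proof.
move=> h k a; rewrite mcoeffM; apply: abs_sum_le => //; first lra.
by move=> i _; rewrite (absM habs); apply: Rmult_le1 => //; apply: abs_ge0.
Qed.

Lemma mbnd1 (a : 'X_{1..m}) : (abs (1 : {mpoly F[m]})@_a <= 1)%coqR.
Proof.
rewrite mcoeff1; case: eqP => _; rewrite ?(abs1 habs) ?mulr0n ?(abs0 habs); lra.
Qed.

Lemma comp_mpolyX_bnd (b a : 'X_{1..m}) : (abs ('X_[b] \mPo lq)@_a <= 1)%coqR.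
Proof.
rewrite comp_mpolyX; elim/big_rec: _ a => [|i x _ h]; first exact: mbnd1.
apply: mbndM => //; elim: (b i) => [|k ih]; first exact: mbnd1.
by rewrite exprS; apply: mbndM.
Qed.

(** By homogeneity only monomials of the degree of a contribute, with multipliers of size at most 1:
    the substitution does not increase norms. *)
Lemma fsub_term f a b : (abs ((trunc (mdeg a) f)@_b * ('X_[b] \mPo lq)@_a) <=
  if mdeg b == mdeg a then abs (f b) else 0)%coqR.
Proof.
rewrite truncE; have [->|ne] := eqVneq (mdeg b) (mdeg a).
  rewrite leqnn (absM habs) -[X in (_ <= X)%coqR]Rmult_1_r.
  by apply: Rmult_le_compat_l; [exact: abs_ge0 | exact: comp_mpolyX_bnd].
rewrite (dhomog_nemf_coeff (comp_mpolyX_homog b)) ?mulr0 1?eq_sym //.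
by rewrite (abs0 habs); lra.
Qed.

Lemma fsub_le f a C : (0 <= C)%coqR ->
  (forall b, mdeg b = mdeg a -> (abs (f b) <= C)%coqR) -> (abs (fsub f a) <= C)%coqR.
Proof.
move=> C0 h; rewrite /= comp_mpolyEX raddf_sum /=; apply: abs_sum_le => // b _.
rewrite mcoeffZ; apply: Rle_trans (fsub_term f a b) _.
by case: eqP => // /h.
Qed.

Lemma fsub_lt f a C : (0 < C)%coqR ->
  (forall b, mdeg b = mdeg a -> (abs (f b) < C)%coqR) -> (abs (fsub f a) < C)%coqR.
Proof.
move=> C0 h; rewrite /= comp_mpolyEX raddf_sum /=; apply: abs_sum_lt => // b _.
rewrite mcoeffZ; apply: Rle_lt_trans (fsub_term f a b) _.
by case: eqP => // /h.
Qed.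

Lemma inA_fsub f : inA abs f -> inA abs (fsub f).
Proof.
move=> h e e0; have [N hN] := h e e0; exists N => a Na.
by apply: fsub_lt => // b E; apply: hN; rewrite E.
Qed.
End Subst.

Lemma fsubK m (lq lq' : m.-tuple {mpoly F[m]}) :
  (forall i, tnth lq i \is 1.-homog) -> (forall i, tnth lq' i \is 1.-homog) ->
  (forall i, tnth lq i \mPo lq' = 'X_i) -> cancel (fsub lq) (fsub lq').
Proof.
move=> hq hq' e f; apply: fpsP => a.
have E (p : {mpoly F[m]}) : (p \mPo lq) \mPo lq' = p.
  rewrite -[RHS]comp_mpoly_id [p \mPo lq]comp_mpolyEX [RHS]comp_mpolyEX raddf_sum.
  apply: eq_bigr => b _ /=.
  rewrite comp_mpolyZ !comp_mpolyX rmorph_prod; congr (_ *: _).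
  by apply: eq_bigr => i _; rewrite rmorphXn /= e tnth_mktuple.
have -> : f a = ((trunc (mdeg a) f \mPo lq) \mPo lq')@_a by rewrite E truncE leqnn.
by apply: comp_mpoly_deg => // b ba; rewrite truncE ba leqnn (fsubE hq f (n := mdeg a)) ?ba.
Qed.

End LinearSubstitution.

(** * Shears that make series distinguished *)

Section Shear.
Variables (F : closedFieldType) (abs : F -> R) (habs : is_nonarch_abs abs).
Variable m : nat.
Implicit Types f g : fps F m.+1.
Local Notation dX d := (U_(ord0) *+ d : 'X_{1..m.+1})%MM.

Definition shear (c : 'I_m.+1 -> F) : m.+1.-tuple {mpoly F[m.+1]} :=
  [tuple if i == ord0 then 'X_ord0 else 'X_i + c i *: 'X_ord0 | i < m.+1].

Lemma shear_homog c i : tnth (shear c) i \is 1.-homog.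
Proof.
rewrite tnth_mktuple; case: ifP => _; first by rewrite dhomogX /= mdeg1.
by apply: dhomogD; [|apply: dhomogZ]; rewrite dhomogX /= mdeg1.
Qed.

Lemma shear_bnd c : (forall i, (abs (c i) <= 1)%coqR) ->
  forall i a, (abs (tnth (shear c) i)@_a <= 1)%coqR.
Proof.
move=> hc i a; have b01 (b : bool) : (abs b%:R <= 1)%coqR.
  by case: b; rewrite ?mulr1n ?mulr0n ?(abs1 habs) ?(abs0 habs); lra.
rewrite tnth_mktuple; case: ifP => _; first by rewrite mcoeffX.
rewrite mcoeffD mcoeffZ !mcoeffX; apply: absD_le => //.
by rewrite (absM habs); apply: Rmult_le1 => //; apply: abs_ge0.
Qed.

Lemma shearK c i : tnth (shear c) i \mPo (shear (fun i => - c i)) = 'X_i.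
Proof.
rewrite tnth_mktuple; case: eqP => [->|/eqP i0].
  by rewrite comp_mpolyXU -tnth_nth tnth_mktuple eqxx.
rewrite comp_mpolyD comp_mpolyZ !comp_mpolyXU -!tnth_nth !tnth_mktuple eqxx (negbTE i0).
by rewrite scaleNr subrK.
Qed.

(** The point (1, 0, ..., 0) annihilates every monomial that is not a power of the main variable. *)
Lemma meval_main d (x : {mpoly F[m.+1]}) : x \is d.-homog ->
  x.@[fun i => (i == ord0)%:R] = x@_(dX d).
Proof.
move=> hx; rewrite mevalE.
have E (b : 'X_{1..m.+1}) : b \in msupp x ->
    x@_b * \prod_i (i == ord0)%:R ^+ b i = if b == dX d then x@_b else 0.
  move=> /(dhomogP _ _ _ hx) db'; have {db'} db : mdeg b = d by exact: db'.
  rewrite big_ord_recl eqxx expr1n mul1r.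
  case: eqP => [->|ne].
    rewrite big1 ?mulr1 // => i _; rewrite mulmnE mnm1E.
    by rewrite (negbTE (neq_lift _ _)) mul0n.
  have [i bi] : exists i, b (lift ord0 i) != 0%N.
    apply: contrapT => h; apply: ne; apply/mnmP => j; rewrite mulmnE mnm1E.
    have h' i : b (lift ord0 i) = 0%N.
      by apply: contrapT => hi; apply: h; exists i; apply/eqP.
    case: (unliftP ord0 j) => [i ->|->]; first by rewrite h'.
    by rewrite eqxx mul1n -db mdegE big_ord_recl big1 ?addn0 // => k; rewrite h'.
  rewrite (bigD1 i) //= expr0n (negbTE bi) mul0r mulr0.
  by [].
rewrite (eq_big_seq _ E) -big_mkcond /=.
have [dx|dx] := boolP (dX d \in msupp x).
  by rewrite (big_rem _ dx) /= eqxx big1_seq ?addr0 // => b /andP[/eqP->];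
     rewrite mem_rem_uniq ?msupp_uniq // inE eqxx.
rewrite big1_seq; first by rewrite (memN_msupp_eq0 dx).
by move=> b /andP[/eqP->]; rewrite (negbTE dx).
Qed.

(** The right side is the degree-d form of f at the point c, so a good shear is a point where this
    form is large. *)
Lemma coef_shear c d f : c ord0 = 1 -> fsub (shear c) f (dX d) =
  \sum_(b : 'X_{1..m.+1 < d.+1} | mdeg b == d) f b * \prod_i c i ^+ b i.
Proof.
move=> c0; pose h := \sum_(b : 'X_{1..m.+1 < d.+1} | mdeg b == d) f b *: 'X_[b].
rewrite /fsub [LHS]/= mdeg_dX (comp_mpoly_deg (shear_homog c) (q := h)); last first.
  move=> b; rewrite mdeg_dX => bd; rewrite truncE bd leqnn raddf_sum /=.
  have lt : (mdeg b < d.+1)%N by rewrite bd.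
  rewrite (bigD1 (BMultinom lt)) /= ?bd ?eqxx // mcoeffZ mcoeffX eqxx mulr1.
  rewrite big1 ?addr0 // => b' /andP[_ ne]; rewrite mcoeffZ mcoeffX.
  by case: eqP => [e|]; rewrite ?mulr0 //; case/eqP: ne; apply: val_inj.
rewrite {}/h (raddf_sum (comp_mpoly (shear c))) raddf_sum; apply: eq_bigr => b /eqP bd /=.
rewrite comp_mpolyZ mcoeffZ; congr (_ * _).
rewrite -{1}bd -(meval_main (comp_mpolyX_homog (shear_homog c) b)).
rewrite comp_mpoly_meval mevalX; apply: eq_bigr => i _; congr (_ ^+ _).
rewrite tnth_mktuple; case: eqP => [->|/eqP i0]; first by rewrite mevalXU eqxx c0.
by rewrite mevalD mevalZ !mevalXU eqxx (negbTE i0) add0r mulr1.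
Qed.

Lemma lex_main d (b : 'X_{1..m.+1}) : mdeg b = d -> (b <= dX d)%O.
Proof.
move=> bd; rewrite leNgt; apply/negP => /ltmcP; rewrite mdeg_dX bd => /(_ erefl)[i e].
have b0 : (b ord0 <= d)%N by rewrite -bd mdegE big_ord_recl leq_addr.
case: (unliftP ord0 i) => [j|] i0; last by rewrite i0 dX0 ltnNge b0.
have E := e ord0; rewrite i0 dX0 in E.
have := @dX_uniq m d b; rewrite bd leqnn -E // leqnn => /(_ isT isT) ->.
by rewrite ltnn.
Qed.

(** Norms do not grow, so the coefficient in question is of maximal size. Monomials above it have
    degree greater than |a|, where all coefficients of f are smaller than |f a|. *)
Lemma shear_lead c f a : (forall i, (abs (c i) <= 1)%coqR) -> lead abs f a ->
  (abs (f a) <= abs (fsub (shear c) f (dX (mdeg a))))%coqR ->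
  lead abs (fsub (shear c) f) (dX (mdeg a)).
Proof.
move=> hc la ge; have hb := shear_bnd hc; have hh := shear_homog c.
have pa := abs_gt0 habs (proj1 la).
have le b : (abs (fsub (shear c) f b) <= abs (f a))%coqR.
  by apply: fsub_le => // [|x _]; [lra | apply: lead_bnd la _].
split; first by apply/eqP => /(abs_eq0 habs); lra.
move=> b; split; first by have := le b; lra.
move=> h; apply: Rlt_le_trans ge; apply: fsub_lt => // x xb.
apply: (proj2 (proj2 la x)); apply: lt_mdeg_ltmc; rewrite xb.
rewrite ltn_neqAle -{2}(mdeg_dX m (mdeg a)) (lemc_mdeg (ltW h)) andbT.
by apply/eqP => e; have := lex_main (esym e); rewrite leNgt h.
Qed.

(** One shear serves two series: it will be applied to f and its restriction to a smaller ball. *)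
Lemma exists_shear f g : inA abs f -> f != 0 -> inA abs g -> g != 0 ->
  exists c d e, [/\ forall i, (abs (c i) <= 1)%coqR,
    lead abs (fsub (shear c) f) (dX d) & lead abs (fsub (shear c) g) (dX e)].
Proof.
move=> Af f0 Ag g0; have [a la] := lead_ex habs Af f0; have [b lb] := lead_ex habs Ag g0.
pose B := (maxn (mdeg a) (mdeg b)).+1.
(* Kronecker substitution: c_i = t ^ (B ^ i - 1), so that c_0 = 1. *)
pose kap (x : 'X_{1..m.+1}) := (\sum_i x i * (B ^ i).-1)%N.
have B0 (i : 'I_m.+1) : (0 < B ^ i)%N by rewrite expn_gt0.
have kapE x : (kap x + mdeg x = \sum_i x i * B ^ i)%N.
  rewrite mdegE /kap -big_split /=; apply: eq_bigr => i _.
  by rewrite -mulnSr prednK.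
have kap_inj d (x y : 'X_{1..m.+1}) : (d < B)%N -> mdeg x = d -> mdeg y = d -> kap x = kap y -> x = y.
  move=> dB xd yd e; apply/mnmP; apply: (@digits_inj B).
  - by move=> i; apply: leq_ltn_trans dB; rewrite -xd mdegE (bigD1 i) //= leq_addr.
  - by move=> i; apply: leq_ltn_trans dB; rewrite -yd mdegE (bigD1 i) //= leq_addr.
  by rewrite -!kapE e xd yd.
(* The degree-d form of h along the curve c(t). Injectivity of [kap] keeps each coefficient of h as
   a coefficient of P. *)
pose P d (h : fps F m.+1) : {poly F} := \sum_(x : 'X_{1..m.+1 < d.+1} | mdeg x == d) (h x)%:P * 'X^(kap x).
have coefP d h x : (d < B)%N -> mdeg x = d -> (P d h)`_(kap x) = h x.
  move=> dB xd; rewrite /P coef_sum.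
  have lt : (mdeg x < d.+1)%N by rewrite xd.
  rewrite (bigD1 (BMultinom lt)) /= ?xd ?eqxx // coefCM coefXn eqxx mulr1.
  rewrite big1 ?addr0 // => y /andP[/eqP yd ne]; rewrite coefCM coefXn.
  case: eqP => [e|]; rewrite ?mulr0 //; case/eqP: ne; apply: val_inj => /=.
  exact: (kap_inj d).
have aB : (mdeg a < B)%N by rewrite ltnS leq_maxl.
have bB : (mdeg b < B)%N by rewrite ltnS leq_maxr.
have nz (h : fps F m.+1) x : (mdeg x < B)%N -> h x != 0 -> P (mdeg x) h != 0.
  by move=> xB; apply: contraNneq => e; rewrite -(coefP (mdeg x)) // e coef0.
have [t [t1 hf hg]] := poly_generic habs (nz f a aB (proj1 la)) (nz g b bB (proj1 lb)).
pose c (i : 'I_m.+1) := t ^+ (B ^ i).-1.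
have c0 : c ord0 = 1 by rewrite /c expn0.
have hc i : (abs (c i) <= 1)%coqR.
  rewrite (absX habs) -(pow1 (B ^ i).-1); apply: pow_incr.
  by split=> //; apply: abs_ge0.
have val (h : fps F m.+1) d : (P d h).[t] = fsub (shear c) h (dX d).
  rewrite coef_shear // horner_sum; apply: eq_bigr => x _.
  rewrite hornerM hornerC hornerXn /kap expr_sum; congr (_ * _).
  by apply: eq_bigr => i _; rewrite /c -exprM mulnC.
exists c, (mdeg a), (mdeg b); split=> //; apply: shear_lead => //; rewrite -val.
  by have := hf (kap a); rewrite coefP.
by have := hg (kap b); rewrite coefP.
Qed.

End Shear.

(** * Gauss' lemma in a gcd domain *)

Section GcdDomain.
Variable T : comNzRingType.

Definition dv (a b : T) : Prop := exists x, b = a * x.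

Definition is_gcd2 (a b g : T) : Prop :=
  [/\ dv g a, dv g b & forall d, dv d a -> dv d b -> dv d g].

Lemma dv_refl a : dv a a. Proof. by exists 1; rewrite mulr1. Qed.
Lemma dv0 a : dv a 0. Proof. by exists 0; rewrite mulr0. Qed.
Lemma dv_trans a b c : dv a b -> dv b c -> dv a c.
Proof. by move=> [x ->] [y ->]; exists (x * y); rewrite mulrA. Qed.
Lemma dvD a b c : dv a b -> dv a c -> dv a (b + c).
Proof. by move=> [x ->] [y ->]; exists (x + y); rewrite mulrDr. Qed.
Lemma dvB a b c : dv a b -> dv a c -> dv a (b - c).
Proof. by move=> [x ->] [y ->]; exists (x - y); rewrite mulrBr. Qed.
Lemma dv_mulr a b c : dv a b -> dv a (b * c).
Proof. by move=> [x ->]; exists (x * c); rewrite mulrA. Qed.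
Lemma dv_mull a b c : dv a b -> dv a (c * b).
Proof. by move=> h; rewrite mulrC; apply: dv_mulr. Qed.
Lemma dv_sum (I : Type) (r : seq I) (P : pred I) (G : I -> T) a :
  (forall i, P i -> dv a (G i)) -> dv a (\sum_(i <- r | P i) G i).
Proof. by move=> h; elim/big_ind: _ => //; [exact: dv0 | move=> x y; apply: dvD]. Qed.
End GcdDomain.

Section Gauss.
Variable D : idomainType.
Hypothesis gcdD : forall a b : D, exists g, is_gcd2 a b g.
Implicit Types (a b c d : D) (p q h : {poly D}).

Lemma dv_mul2l a b c : a != 0 -> dv (a * b) (a * c) -> dv b c.
Proof. by move=> a0 [x]; rewrite -mulrA => /(mulfI a0) ->; exists x. Qed.

Lemma gcd_seq (s : seq D) : exists g, (forall x, x \in s -> dv g x) /\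
  forall d, (forall x, x \in s -> dv d x) -> dv d g.
Proof.
elim: s => [|a s [g [hg hg']]]; first by exists 0; split=> // d _; apply: dv0.
have [g' [ga gs mx]] := gcdD a g; exists g'; split=> [x|d hd].
  by rewrite inE => /orP[/eqP->//|/hg]; apply: dv_trans.
apply: mx; first by apply: hd; rewrite mem_head.
by apply: hg' => x xs; apply: hd; rewrite inE xs orbT.
Qed.

(** Euclid's lemma: the gcd of d c and all d x is d e with e dividing c and every x, so e is a unit;
    and c divides that gcd. *)
Lemma coprime_dv c d (s : seq D) :
  (forall y, dv y c -> (forall x, x \in s -> dv y x) -> dv y 1) ->
  (forall x, x \in s -> dv c (d * x)) -> dv c d.
Proof.
move=> cop h; have [->|d0] := eqVneq d 0; first exact: dv0.
have [G [hG hG']] := gcd_seq (map ( *%R d) (c :: s)).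
have [e Ge] : dv d G by apply: hG' => x /mapP[y _ ->]; apply/dv_mulr/dv_refl.
have e1 : dv e 1.
  apply: cop => [|x xs]; apply: (dv_mul2l d0); rewrite -Ge; apply: hG.
    exact: mem_head.
  by rewrite inE map_f ?orbT.
have : dv c G.
  apply: hG' => x /=; rewrite inE => /orP[/eqP->|/mapP[y ys ->]]; last exact: h.
  exact/dv_mull/dv_refl.
case: e1 => y e1 cG; rewrite -[d]mulr1 e1 mulrA -Ge; exact: dv_mulr.
Qed.

Definition dvc c p : Prop := forall i, dv c p`_i.
Definition primitive p : Prop := forall y, dvc y p -> dv y 1.

Lemma dvc_seq c p : (forall x, x \in (p : seq D) -> dv c x) -> dvc c p.
Proof.
move=> h i; have [lt|ge] := ltnP i (size p); first by apply: h; apply: mem_nth.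
by rewrite nth_default //; apply: dv0.
Qed.
Lemma dvc_mem c p x : dvc c p -> x \in (p : seq D) -> dv c x.
Proof. by move=> h /(nthP 0)[i _ <-]. Qed.

Lemma dvcP c p : dvc c p -> exists q, p = c *: q.
Proof.
move=> /choice[w hw]; exists (\poly_(i < size p) w i); apply/polyP => i.
rewrite coefZ coef_poly; case: ltnP => // ge.
by rewrite mulr0 nth_default.
Qed.
Lemma dvcZ c p : dvc c (c *: p).
Proof. by move=> i; rewrite coefZ; apply/dv_mulr/dv_refl. Qed.
Lemma dvcD c p q : dvc c p -> dvc c q -> dvc c (p + q).
Proof. by move=> h k i; rewrite coefD; apply: dvD. Qed.
Lemma dvcB c p q : dvc c p -> dvc c q -> dvc c (p - q).
Proof. by move=> h k i; rewrite coefB; apply: dvB. Qed.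
Lemma dvc_mulr c p q : dvc c p -> dvc c (p * q).
Proof. by move=> h i; rewrite coefM; apply: dv_sum => j _; apply: dv_mulr. Qed.
Lemma dvc_mull c p q : dvc c p -> dvc c (q * p).
Proof. by move=> h; rewrite mulrC; apply: dvc_mulr. Qed.
Lemma dvc_trans a b p : dv a b -> dvc b p -> dvc a p.
Proof. by move=> h k i; apply: dv_trans h (k i). Qed.
Lemma dvc_scale a b p : a != 0 -> dvc (a * b) (a *: p) -> dvc b p.
Proof. by move=> a0 h i; apply: (dv_mul2l a0); rewrite -coefZ. Qed.

Lemma size_sub_lead p : p != 0 -> (size (p - lead_coef p *: 'X^((size p).-1))%R < size p)%N.
Proof.
move=> p0; rewrite -[X in (_ < X)%N]prednK ?size_poly_gt0 // ltnS.
apply/leq_sizeP => j; rewrite leq_eqVlt coefB coefZ coefXn => /orP[/eqP<-|lt].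
  by rewrite eqxx mulr1 lead_coefE subrr.
rewrite gtn_eqF // mulr0 subr0 nth_default //.
by rewrite -[size p]prednK ?size_poly_gt0.
Qed.

Lemma content_ex p : exists e q, [/\ p = e *: q & p != 0 -> e != 0 /\ primitive q].
Proof.
have [e [he he']] := gcd_seq p; have [q hq] := dvcP (dvc_seq he).
exists e, q; split=> // p0; have e0 : e != 0.
  by apply: contraNneq p0 => e0; rewrite hq e0 scale0r.
split=> // y yq; apply: (dv_mul2l e0); rewrite mulr1; apply: he' => x xp.
apply: dvc_mem xp => i; rewrite hq coefZ; have [w ->] := yq i.
by exists w; rewrite mulrA.
Qed.

(** Induction on the total size, removing the leading term of either factor; gcds of coefficients
    take the place of prime elements. *)
Lemma gauss_dvc h q c : primitive h -> dvc c (h * q) -> dvc c q.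
Proof.
have [n] := ubnP (size h + size q); elim: n => // n ih in h q c *.
rewrite ltnS => le ph hc.
have [->|q0] := eqVneq q 0; first by move=> i; rewrite coef0; apply: dv0.
(* Divide c and q by their common content e. It then remains to show that the cofactor c' is a
   unit. *)
have [e [he he']] := gcd_seq (c :: q).
have [q' qE] : exists q', q = e *: q'.
  by apply/dvcP/dvc_seq => x xq; apply: he; rewrite inE xq orbT.
have [c' cE] := he c (mem_head _ _).
have e0 : e != 0 by apply: contraNneq q0 => e0; rewrite qE e0 scale0r.
have sq : size q = size q' by rewrite qE size_scale.
have cop y : dv y c' -> dvc y q' -> dv y 1.
  move=> [w wE] yq; apply: (dv_mul2l e0); rewrite mulr1; apply: he' => x.
  rewrite inE => /orP[/eqP->|xq]; first by rewrite cE wE mulrA; apply/dv_mulr/dv_refl.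
  apply: dvc_mem xq => i; rewrite qE coefZ; have [v ->] := yq i.
  by exists v; rewrite mulrA.
have hc' : dvc c' (h * q').
  by apply: (dvc_scale e0); rewrite -cE scalerAr -qE.
suff [y y1] : dv c' 1.
  by rewrite qE -[e]mulr1 y1 mulrA -cE -scalerA; apply: dvcZ.
have q'0 : q' != 0 by apply: contraNneq q0 => q'0; rewrite qE q'0 scaler0.
set a := lead_coef q'; set b := lead_coef h.
(* A common divisor of c' and a divides h times q' without its leading term, hence by induction all
   of q', and is a unit. As c' divides a b, it divides b. *)
have cb : dv c' b.
  apply: (@coprime_dv _ _ [:: a]) => [y yc ya|x]; last first.
    by rewrite inE => /eqP->; rewrite /a /b -lead_coefM lead_coefE.
  have {}ya := ya a (mem_head _ _); have lt := size_sub_lead q'0.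
  have yX : dvc y (a *: 'X^((size q').-1)).
    by apply: dvc_trans ya (dvcZ _ _).
  apply: cop => //; rewrite -[q'](subrK (a *: 'X^((size q').-1))); apply: dvcD => //.
  apply: (ih h) => //; first by apply: leq_trans le; rewrite sq ltn_add2l.
  by rewrite mulrBr; apply: dvcB; [apply: dvc_trans yc hc' | apply: dvc_mull].
have cX : dvc c' (b *: 'X^((size h).-1)) by apply: dvc_trans cb (dvcZ _ _).
(* Without its leading term h is d times a primitive polynomial; by induction c' divides d q', hence
   d, hence all of h. *)
pose h1 := h - b *: 'X^((size h).-1).
have [d [h1' [hE hd]]] := content_ex h1.
apply: ph; rewrite -[h](subrK (b *: 'X^((size h).-1))); apply: dvcD => //.
rewrite -/h1; have [->|h10] := eqVneq h1 0; first by move=> i; rewrite coef0; apply: dv0.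
have [d0 p1] := hd h10; rewrite hE.
apply: dvc_trans (dvcZ _ _); apply: (@coprime_dv _ _ q') => [y yc yq|x xq].
  by apply: cop => //; apply: dvc_seq.
have h0 : h != 0 by apply: contraNneq h10 => h0; rewrite /h1 /b h0 lead_coef0 scale0r subr0.
have : dvc c' (d *: q').
  apply: (ih h1') => //.
    rewrite size_scale // -sq; apply: leq_trans le; rewrite ltn_add2r.
    by rewrite -(size_scale h1' d0) -hE; apply: size_sub_lead.
  rewrite -scalerAr scalerAl -hE mulrBl; apply: dvcB => //; exact: dvc_mulr.
by move=> k; case/(nthP 0): xq => i _ <-; rewrite -coefZ.
Qed.

(** A primitive polynomial that divides after multiplication by a non-zero constant already
    divides. *)
Lemma primitive_dv c p q w : c != 0 -> primitive p -> c *: w = q * p -> exists q', w = p * q'.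
Proof.
move=> c0 pp E; have : dvc c q.
  by apply: (gauss_dvc pp); rewrite mulrC -E; apply: dvcZ.
move=> /dvcP[q' qE]; exists q'; rewrite mulrC.
apply/polyP => i; apply: (mulfI c0).
by rewrite -!coefZ E qE scalerAl.
Qed.

(** [gcdp] is a gcd over the fraction field; its primitive part g divides p and q over D, and
    clearing denominators in the Bezout relation leaves the constant c. *)
Lemma bezout_primitive (p q : {poly D}) : p != 0 -> exists g p' q' u v c,
  [/\ c != 0, p = g * p', q = g * q' & u * p + v * q = c *: g].
Proof.
move=> p0; have g0 : gcdp p q != 0 by rewrite gcdp_eq0 (negbTE p0).
have [e [g [gE /(_ g0)[e0 pg]]]] := content_ex (gcdp p q).
have [/= [c1 w1] c10 E1] := Pdiv.Idomain.dvdpP _ _ (dvdp_gcdl p q).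
have [/= [c2 w2] c20 E2] := Pdiv.Idomain.dvdpP _ _ (dvdp_gcdr p q).
have [p' pE] : exists p', p = g * p'.
  by apply: (primitive_dv (q := e *: w1) c10 pg); rewrite E1 {1}gE -scalerAr -scalerAl.
have [q' qE] : exists q', q = g * q'.
  by apply: (primitive_dv (q := e *: w2) c20 pg); rewrite E2 {1}gE -scalerAr -scalerAl.
have [[u v] /eqpP[[a b] /andP[/= a0 b0] E]] := Bezoutp p q.
exists g, p', q', (a *: u), (a *: v), (b * e); split=> //.
  by rewrite mulf_neq0.
by rewrite -!scalerAl -scalerDr E {1}gE scalerA.
Qed.
End Gauss.

(** * Greatest common divisors on a fixed ball *)

Section ConvRing.
Variables (F : closedFieldType) (abs : F -> R) (habs : is_nonarch_abs abs).
Hypothesis hcomp : abs_complete abs.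
Local Notation inA := (inA abs).
Local Notation lead := (lead abs).

(* The proof of [is_nonarch_abs] is an argument so that the instances below, which
   need it, can recover it by unification. *)
Definition convp (_ : is_nonarch_abs abs) (m : nat) : {pred fps F m} :=
  fun f => `[< inA f >].
Arguments convp : clear implicits.

Lemma convpP m f : reflect (inA f) (f \in convp habs m).
Proof. exact: asboolP. Qed.

Lemma convp_subring m : subring_closed (convp habs m).
Proof.
split=> [|f g /convpP ? /convpP ?|f g /convpP ? /convpP ?]; apply/convpP.
- exact: inA1.
- exact: inAB.
- exact: inAM.
Qed.
HB.instance Definition _ m :=
  GRing.isSubringClosed.Build (fps F m) (convp habs m) (convp_subring m).

Record cfps (h : is_nonarch_abs abs) (m : nat) :=
  Cfps { cval : fps F m; cvalP : cval \in convp h m }.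
Local Notation A m := (cfps habs m).

HB.instance Definition _ m := [isSub for @cval habs m].
HB.instance Definition _ m := [Choice of A m by <:].
HB.instance Definition _ m := [SubChoice_isSubComNzRing of A m by <:].

Section Inverse.
Variable m : nat.
Definition cfps_unit : pred (A m) := fun x => `[< exists y, y * x = 1 >].
Definition cfps_inv (x : A m) : A m :=
  if pselect (exists y, y * x = 1) is left e then projT1 (cid e) else x.
Lemma cfps_mulVr : {in cfps_unit, left_inverse 1 cfps_inv *%R}.
Proof.
move=> x /asboolP e; rewrite /cfps_inv; case: pselect => // e'.
exact: projT2 (cid e').
Qed.
Lemma cfps_unitP (x y : A m) : y * x = 1 -> cfps_unit x.
Proof. by move=> e; apply/asboolP; exists y. Qed.
Lemma cfps_invr_out : {in [predC cfps_unit], cfps_inv =1 id}.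
Proof. by move=> x /asboolP e; rewrite /cfps_inv; case: pselect. Qed.
HB.instance Definition _ :=
  GRing.ComNzRing_hasMulInverse.Build (A m) cfps_mulVr cfps_unitP cfps_invr_out.

Lemma cfps_integral (x y : A m) : x * y = 0 -> (x == 0) || (y == 0).
Proof.
move=> /(congr1 val); rewrite rmorphM rmorph0 /=.
move=> /(inA_domain habs (convpP _ (cvalP x)) (convpP _ (cvalP y))).
by case=> e; apply/orP; [left | right]; apply/eqP/val_inj.
Qed.
HB.instance Definition _ := GRing.ComUnitRing_isIntegral.Build (A m) cfps_integral.
End Inverse.

(** * Polynomials in the main variable as convergent series *)

Section PolyEmbedding.
Variable m : nat.

Definition phi (p : {poly A m}) : fps F m.+1 :=
  (map_poly (@ext F m) (map_poly val p)).[mainX F m].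

Lemma phiD p q : phi (p + q) = phi p + phi q.
Proof. by rewrite /phi !rmorphD hornerD. Qed.
Lemma phiM p q : phi (p * q) = phi p * phi q.
Proof. by rewrite /phi !rmorphM hornerM. Qed.
Lemma phiZ c p : phi (c *: p) = ext (val c) * phi p.
Proof. by rewrite /phi !map_polyZ hornerZ. Qed.
Lemma phiXn d : phi 'X^d = fpsX F (U_(ord0) *+ d)%MM.
Proof. by rewrite /phi !map_polyXn hornerXn fpsX_exp. Qed.

Lemma inA_phi p : inA (phi p).
Proof.
rewrite /phi horner_coef; elim/big_ind: _ => [|x y|i _]; [exact: inA0 | exact: inAD |].
rewrite /mainX fpsX_exp; apply: inAM; [exact: habs | | exact: inA_fpsX].
by rewrite !coef_map; apply: inA_ext => //; apply/(convpP _)/cvalP.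
Qed.

Lemma phi_onto d (s : fps F m.+1) : inA s -> zdeg_lt d s -> exists p, phi p = s.
Proof.
move=> As zs; pose sl i := Fps (fun a : 'X_{1..m} => s (consm i a)).
have Asl i : sl i \in convp habs m.
  apply/convpP => e e0; have [N hN] := As _ e0; exists N => a Na /=.
  by apply: hN; rewrite mdeg_cons; apply: leq_trans (leq_addl _ _).
exists (\poly_(i < d) Cfps (Asl i)); apply: fpsP => a.
rewrite coef_horner coef_map coef_poly; case: ltnP => h /=; first by rewrite cons_tail.
by rewrite zs.
Qed.
End PolyEmbedding.

Definition dvS m (S : fps F m -> Prop) (f g : fps F m) : Prop := exists2 h, S h & g = f * h.
Local Notation dvA := (dvS inA).
Definition gcdA m (f g G : fps F m) : Prop := [/\ inA G, dvA G f, dvA G g &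
  forall H, inA H -> dvA H f -> dvA H g -> dvA H G].

Lemma dvA_refl m (f : fps F m) : dvA f f.
Proof. by exists 1; [exact: inA1 | rewrite mulr1]. Qed.
Lemma dvA0 m (f : fps F m) : dvA f 0.
Proof. by exists 0; [exact: inA0 | rewrite mulr0]. Qed.
Lemma dvA_trans m (f g h : fps F m) : dvA f g -> dvA g h -> dvA f h.
Proof. by move=> [x Ax ->] [y Ay ->]; exists (x * y); [exact: inAM | rewrite mulrA]. Qed.
Lemma dvAD m (f g h : fps F m) : dvA f g -> dvA f h -> dvA f (g + h).
Proof. by move=> [x Ax ->] [y Ay ->]; exists (x + y); [exact: inAD | rewrite mulrDr]. Qed.
Lemma dvA_mull m (f g h : fps F m) : inA h -> dvA f g -> dvA f (h * g).
Proof. by move=> Ah [x Ax ->]; exists (h * x); [exact: inAM | rewrite mulrCA]. Qed.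
Lemma dvA_scl m r (f g : fps F m) : (abs r <= 1)%coqR -> dvA f g -> dvA (scl r f) (scl r g).
Proof. by move=> r1 [x Ax ->]; exists (scl r x); [exact: inA_scl | rewrite rmorphM]. Qed.

Lemma scl_inj m r : r != 0 -> injective (@scl F m r).
Proof. by move=> r0; apply: can_inj (sclK r0). Qed.

Lemma ext_inj m : injective (@ext F m).
Proof.
move=> f g e; apply: fpsP => a; have := congr1 (fun h : fps F m.+1 => h (consm 0 a)) e.
by rewrite !coef_ext consm0 eqxx tail_cons.
Qed.

(** As leading monomials multiply, this makes divisors of a distinguished series distinguished. *)
Lemma dX_addl m (a b : 'X_{1..m.+1}) e : (a + b)%MM = (U_(ord0) *+ e)%MM ->
  a = (U_(ord0) *+ a ord0)%MM.
Proof.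
move=> E; apply/mnmP => i; rewrite mulmnE mnm1E; case: eqP => [<-|/eqP ne]; first by rewrite mul1n.
have := congr1 (fun x : 'X_{1..m.+1} => x i) E.
by rewrite mnmDE mulmnE mnm1E (negbTE ne) mul0n => /eqP; rewrite addn_eq0 => /andP[/eqP].
Qed.

Section Step.
Variable m : nat.
Hypothesis gcdm : forall a b : A m, exists g, is_gcd2 a b g.
Local Notation dX d := (U_(ord0) *+ d : 'X_{1..m.+1})%MM.
Implicit Types f g : fps F m.+1.

(** G is chosen before t, because the same G must serve on the given ball and on a smaller one. *)
Lemma gcd_distinguished f g d : inA f -> inA g -> lead f (dX d) ->
  exists G, [/\ inA G, dvA G f, dvA G g &
    forall t e, t != 0 -> (abs t <= 1)%coqR -> lead (scl t f) (dX e) ->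
      forall H, inA H -> dvA H (scl t f) -> dvA H (scl t g) -> dvA H (scl t G)].
Proof.
move=> Af Ag lf.
have [q [s [Aq As zs E1]]] := wdiv habs hcomp Af lf (inA_fpsX habs (dX d)).
have [q2 [g0 [Aq2 Ag0 zg0 E2]]] := wdiv habs hcomp Af lf Ag.
have [ps Eps] := phi_onto As zs; have [pg Epg] := phi_onto Ag0 zg0.
pose W := 'X^d - ps : {poly A m}.
have EW : phi W = q * f.
  by have := phiD W ps; rewrite subrK phiXn Eps E1 => /esym/addIr.
have coefW (a : 'X_{1..m.+1}) : (d <= a ord0)%N -> (q * f) a = (dX d == a)%:R.
  move=> da; have := congr1 (fun h : fps F m.+1 => h a) E1.
  by rewrite /= => ->; rewrite zs // addr0.
have W0 : q * f != 0.
  apply/eqP => e; have := coefW (dX d); rewrite dX0 e eqxx => /(_ (leqnn _))/eqP.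
  by rewrite coef_0 eq_sym oner_eq0.
have q0 : q != 0 by apply: contraNneq W0 => ->; rewrite mul0r.
have [a la] := lead_ex habs Aq q0.
(* Among monomials of X-degree at least d, only X^d occurs in q f, whose leading monomial is a X^d.
   So q is a unit and f is associated to W. *)
have a0 : a = 0%MM.
  have [+ _] := leadM habs la lf.
  rewrite coefW ?mnmDE ?dX0 ?leq_addl //; case: (dX d =P _) => [e _|_]; last by rewrite mulr0n eqxx.
  by apply/eqP; rewrite -(eqm_add2r (dX d)) add0m -e.
rewrite a0 in la; have [qi Aqi qqi] := lead0_unit habs hcomp Aq la.
have pW0 : W != 0.
  apply: contraNneq W0 => e; rewrite -EW e; apply/eqP; apply: (addrI (phi 0)).
  by rewrite -phiD !addr0.
have [G [W' [g' [u [v [c [c0 EG1 EG2 EG3]]]]]]] := bezout_primitive gcdm pg pW0.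
have fE : f = phi G * (phi W' * qi).
  by rewrite mulrA -phiM -EG1 EW mulrAC qqi mul1r.
have Gf : dvA (phi G) f.
  by exists (phi W' * qi) => //; apply: inAM => //; apply: inA_phi.
exists (phi G); split=> //; first exact: inA_phi.
  rewrite E2; apply: dvAD; first exact: dvA_mull.
  by rewrite -Epg EG2 phiM; exists (phi g') => //; apply: inA_phi.
move=> t e t0 t1 lt H AH Hf Hg.
have st x : inA x -> inA (scl t x) by apply: inA_scl.
have [h Ah hE] := Hf.
have tf0 : scl t f != 0.
  by apply/eqP => z; case: lt; rewrite z coef_0 eqxx.
have H0 : H != 0 by apply: contraNneq tf0 => z; rewrite hE z mul0r.
have h0 : h != 0 by apply: contraNneq tf0 => z; rewrite hE z mulr0.
have [x lx] := lead_ex habs AH H0; have [y ly] := lead_ex habs Ah h0.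
have Hh := leadM habs lx ly; rewrite -hE in Hh.
have xE := dX_addl (lead_uniq Hh lt); rewrite xE in lx.
have AGt : inA (scl t (phi G)) by apply: st; apply: inA_phi.
have [q' [s' [Aq' As' zs' E']]] := wdiv habs hcomp AH lx AGt.
pose cc := scl t (ext (val c)).
have Ac : inA (ext (val c)) by apply: inA_ext => //; apply/(convpP _)/cvalP.
(* c G = u W + v g0, where W = q f and g0 = g - q2 f. *)
have [k Ak kE] : dvA H (cc * scl t (phi G)).
  rewrite -rmorphM -phiZ -EG3 phiD !phiM EW Epg.
  have -> : g0 = g - q2 * f by rewrite E2 addrC addKr.
  rewrite rmorphD !rmorphM rmorphB rmorphM.
  apply: dvAD; first by rewrite mulrA; apply: dvA_mull => //; apply: inAM => //; apply: st => //; apply: inA_phi.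
  apply: dvA_mull; first by apply: st; apply: inA_phi.
  rewrite -mulNr; apply: dvAD => //; apply: dvA_mull => //; apply: inAN => //.
  exact: st.
have zc : zdeg_lt 1 cc.
  move=> b b0; rewrite coef_scl coef_ext; case: eqP => [z|]; last by rewrite mul0r.
  by rewrite z in b0.
(* cc is free of X, so this multiple of H has X-degree below the distinguished degree of H;
   [wdiv_uniq] makes its cofactor zero. *)
have E3 : cc * s' = (k - cc * q') * H.
  have -> : s' = scl t (phi G) - q' * H by rewrite E' addrC addKr.
  by rewrite mulrBr kE; ring.
have z3 : zdeg_lt (x ord0) ((k - cc * q') * H).
  by rewrite -E3; apply: (@zdeg_ltM _ _ 0).
have A3 : inA (k - cc * q') by apply: inAB => //; apply: inAM => //; apply: st.
have := wdiv_uniq habs AH lx A3 z3 => k0; rewrite k0 mul0r in E3.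
have [cc0|s0] := inA_domain habs (st _ _ Ac) As' E3; last first.
  by exists q' => //; rewrite E' s0 addr0 mulrC.
case/eqP: c0; apply: val_inj; apply: ext_inj; apply: (scl_inj t0).
transitivity (0 : fps F m.+1); [exact: cc0 | by rewrite !rmorph0].
Qed.

End Step.

(** Both radii are treated in one statement because a single G, found after a single shear, has to
    serve for both. *)
Definition gcd_pair m : Prop := forall r, r != 0 -> (abs r <= 1)%coqR ->
  forall f g : fps F m, inA f -> inA g ->
  exists G, gcdA f g G /\ gcdA (scl r f) (scl r g) (scl r G).

Lemma gcdA_transport m (s t : fps F m -> fps F m) f g G :
  {morph s : x y / x * y} -> {morph t : x y / x * y} -> cancel s t -> cancel t s ->
  (forall x, inA x -> inA (s x)) -> (forall x, inA x -> inA (t x)) ->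
  gcdA (s f) (s g) G -> gcdA f g (t G).
Proof.
move=> sM tM st ts As At [AG Gf Gg mx].
have ds x y : dvA x y -> dvA (s x) (s y).
  by move=> [h Ah ->]; exists (s h); rewrite ?sM //; apply: As.
have dt x y : dvA x y -> dvA (t x) (t y).
  by move=> [h Ah ->]; exists (t h); rewrite ?tM //; apply: At.
split; first exact: At.
- by rewrite -[f]st; apply: dt.
- by rewrite -[g]st; apply: dt.
move=> H AH Hf Hg; rewrite -[H]st; apply/dt/mx; [exact: As | exact: ds | exact: ds].
Qed.

(** Without variables every non-zero series is a unit. *)
Lemma gcd_pair0 : gcd_pair 0.
Proof.
have key (f g : fps F 0) : inA f -> inA g -> f != 0 -> gcdA f g 1.
  move=> Af Ag f0; have [a la] := lead_ex habs Af f0.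
  rewrite [a]nvar0_mnmE // in la; have [v Av uv] := lead0_unit habs hcomp Af la.
  split; [exact: inA1 | by exists f; rewrite ?mul1r | by exists g; rewrite ?mul1r |].
  by move=> H AH Hf _; rewrite -uv mulrC; apply: dvA_mull.
move=> r r0 r1 f g Af Ag; have [->|f0] := eqVneq f 0.
  exists g; rewrite rmorph0; split; split=> //; try exact: dvA0; try exact: dvA_refl.
  exact: inA_scl.
exists 1; rewrite rmorph1; split; first exact: key.
apply: key; try exact: inA_scl.
by apply: contraNneq f0 => e; apply/eqP; apply: (scl_inj r0); rewrite e rmorph0.
Qed.

Lemma gcd_pairS m : gcd_pair m -> gcd_pair m.+1.
Proof.
move=> ih r r0 r1 f g Af Ag; have [->|f0] := eqVneq f 0.
  exists g; rewrite rmorph0; split; split=> //; try exact: dvA0; try exact: dvA_refl.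
  exact: inA_scl.
(* The induction hypothesis with r = 1 gives the gcd domain that Gauss' lemma requires. *)
have gcdm (a b : A m) : exists g, is_gcd2 a b g.
  have [|G [[AG Ga Gb mx] _]] := ih 1 (oner_neq0 F) _ _ _ (convpP _ (cvalP a)) (convpP _ (cvalP b)).
    by rewrite (abs1 habs); lra.
  have lift (x y : A m) : dvA (val x) (val y) -> dv x y.
    by move=> [h /convpP Ah e]; exists (Cfps Ah); apply: val_inj; rewrite rmorphM.
  have proj (x y : A m) : dv x y -> dvA (val x) (val y).
    by move=> [h ->]; exists (val h); [apply/convpP/cvalP | rewrite rmorphM].
  have AG' : G \in convp habs m by apply/convpP.
  exists (Cfps AG'); split; [exact: lift | exact: lift |].
  by move=> d /proj da /proj db; apply: lift; apply: mx => //; apply/convpP/cvalP.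
have f0' : scl r f != 0.
  by apply: contraNneq f0 => e; apply/eqP; apply: (scl_inj r0); rewrite e rmorph0.
have [c [d [e [hc lf lf']]]] := exists_shear habs Af f0 (inA_scl habs r1 Af) f0'.
have hc' i : (abs (- c i) <= 1)%coqR by rewrite (absN habs).
pose s := fsub (shear c); pose t := fsub (shear (fun i => - c i)).
have sM : {morph s : x y / x * y} by move=> x y; apply: fsubM => i; apply: shear_homog.
have tM : {morph t : x y / x * y} by move=> x y; apply: fsubM => i; apply: shear_homog.
have st : cancel s t.
  by apply: fsubK => i; [apply: shear_homog | apply: shear_homog | apply: shearK].
have ts : cancel t s.
  apply: fsubK => i; [exact: shear_homog | exact: shear_homog |].
  have E : (fun i => - - c i) = c by apply: funext => j; rewrite opprK.
  by have := shearK (fun i => - c i) i; rewrite E.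
have As x : inA x -> inA (s x).
  by apply: inA_fsub => //; [apply: shear_homog | apply: shear_bnd].
have At x : inA x -> inA (t x).
  by apply: inA_fsub => //; [apply: shear_homog | apply: shear_bnd].
(* Shears are homogeneous, hence commute with rescaling. *)
have ss x : s (scl r x) = scl r (s x) by apply: fsub_scl; apply: shear_homog.
have tt x : t (scl r x) = scl r (t x) by apply: fsub_scl; apply: shear_homog.
have [G [AG Gf Gg mx]] := gcd_distinguished gcdm (As _ Af) (As _ Ag) lf.
have key u k : u != 0 -> (abs u <= 1)%coqR -> lead (scl u (s f)) (U_(ord0) *+ k)%MM ->
    gcdA (scl u (s f)) (scl u (s g)) (scl u G).
  move=> u0 u1 lu; split; [exact: inA_scl | exact: dvA_scl | exact: dvA_scl |].
  exact: mx u0 u1 lu.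
exists (t G); split.
  apply: gcdA_transport sM tM st ts As At _.
  have := key 1 d (oner_neq0 F); rewrite !scl1; apply=> //.
  by rewrite (abs1 habs); lra.
rewrite -tt; apply: gcdA_transport sM tM st ts As At _.
by rewrite !ss; apply: (key r e) => //; rewrite -ss.
Qed.

Theorem gcd_pair_all m : gcd_pair m.
Proof. by elim: m => [|m ih]; [exact: gcd_pair0 | exact: gcd_pairS]. Qed.

End ConvRing.

(** * Entire functions *)

Section Families.
Variables (F : closedFieldType) (abs : F -> R) (habs : is_nonarch_abs abs).
Hypotheses (hcomp : abs_complete abs) (hnt : abs_nontrivial abs).
Variable m : nat.
Implicit Types f g G H : fps F m.
Local Notation inA := (@inA F abs m).
Local Notation lead := (@lead F abs m).
Local Notation bnd := (@bnd F abs m).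
Local Notation dvA := (dvS inA).

Definition gcdS (S : fps F m -> Prop) k (f : 'I_k -> fps F m) G : Prop :=
  [/\ S G, forall i, dvS S G (f i) &
    forall H, S H -> (forall i, dvS S H (f i)) -> dvS S H G].

Lemma gcd_family r : r != 0 -> (abs r <= 1)%coqR -> forall k (f : 'I_k -> fps F m),
  (forall i, inA (f i)) ->
  exists G, gcdS inA f G /\ gcdS inA (fun i => scl r (f i)) (scl r G).
Proof.
move=> r0 r1; elim=> [|k ih] f Af.
  exists 0; rewrite rmorph0; split; split=> [|[]//|H _ _]; try exact: inA0; try exact: dvA0.
have [G [[AG Gf mx] [AG' Gf' mx']]] := ih (fun i => f (lift ord0 i)) (fun i => Af _).
have [K [[AK KG Kf kx] [AK' KG' Kf' kx']]] := gcd_pair_all habs hcomp r0 r1 AG (Af ord0).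
exists K; split; split=> //.
- move=> i; case: (unliftP ord0 i) => [j ->|-> //].
  exact: dvA_trans (Gf j).
- move=> H AH h; apply: kx => //; apply: mx => // i; exact: h.
- move=> i; case: (unliftP ord0 i) => [j ->|-> //].
  exact: dvA_trans (Gf' j).
- move=> H AH h; apply: kx' => //; apply: mx' => // i; exact: h.
Qed.

Lemma gcd_assoc k (f : 'I_k -> fps F m) G G' : gcdS inA f G -> inA G' ->
  dvA G G' -> dvA G' G -> gcdS inA f G'.
Proof.
move=> [AG Gf mx] AG' h h'; split=> // [i|H AH Hf]; first exact: dvA_trans (Gf i).
by apply: dvA_trans h => //; apply: mx.
Qed.

(** [gcd_family] supplies one gcd that restricts well; any other is associated to it. *)
Lemma gcd_restrict r k (f : 'I_k -> fps F m) G : r != 0 -> (abs r <= 1)%coqR ->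
  (forall i, inA (f i)) -> gcdS inA f G -> gcdS inA (fun i => scl r (f i)) (scl r G).
Proof.
move=> r0 r1 Af [AG Gf mx]; have [K [[AK Kf kx] hK]] := gcd_family r0 r1 Af.
by apply: gcd_assoc hK _ _ _; [exact: inA_scl | apply: dvA_scl => //; apply: mx |
   apply: dvA_scl => //; apply: kx].
Qed.

Lemma scl_cst (r c : F) : scl r (cst m c) = cst m c.
Proof. by apply: fpsP => a /=; case: eqP => [->|]; rewrite ?mul0r // mdeg0 expr0 mulr1. Qed.

Lemma cstM (c d : F) : cst m c * cst m d = cst m (c * d).
Proof. by apply: fpsP => a; rewrite coef_cst /=; case: eqP; rewrite ?mulr0. Qed.

Lemma cst1 : @cst F m 1 = 1.
Proof. by apply: fpsP => a; rewrite coef_1 /= eq_sym; case: eqP. Qed.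

Lemma lead_cst (c : F) : c != 0 -> lead (cst m c) 0%MM.
Proof.
move=> c0; have pc := abs_gt0 habs c0; split; first by rewrite /= eqxx.
move=> b /=; rewrite eqxx; case: eqP => [->|_]; first by rewrite ltxx; split=> //; lra.
by rewrite (abs0 habs); split=> *; lra.
Qed.

Lemma big_radius : exists2 p : F, p != 0 & (1 < abs p)%coqR.
Proof.
have [a [/eqP a0 a1]] := hnt; have pa := abs_gt0 habs a0.
have [lt|[//|gt]] := Rtotal_order (abs a) 1; last by exists a.
exists a^-1; rewrite ?invr_eq0 // (absV habs) //.
by rewrite -Rinv_1; apply: Rinv_lt_contravar; lra.
Qed.

Definition ent f : Prop := forall r, r != 0 -> inA (scl r f).

(** * Gluing gcds on the balls of radius |p|^n *)

Section Glue.
Variables (p : F) (p0 : p != 0) (p1 : (1 < abs p)%coqR).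
Local Notation q := (/ abs p)%coqR.
Local Notation rho n := (p ^+ n).

Let rho0 n : rho n != 0. Proof. exact: expf_neq0. Qed.
Let q01 : (0 < q < 1)%coqR.
Proof.
split; first by apply: Rinv_0_lt_compat; lra.
by rewrite -Rinv_1; apply: Rinv_lt_contravar; lra.
Qed.
Let absq : abs p^-1 = q. Proof. exact: absV. Qed.
Let qn n : (0 < q ^ n)%coqR. Proof. by apply: pow_lt; case: q01. Qed.

Lemma scl_rhoS n f : scl (rho n) f = scl p^-1 (scl (rho n.+1) f).
Proof. by rewrite sclM exprS mulKf. Qed.

Lemma inA_rho n k f : (n <= k)%N -> inA (scl (rho k) f) -> inA (scl (rho n) f).
Proof.
move=> /subnK <-; elim: (k - n)%N => // j ih; rewrite addSn => h; apply: ih.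
by rewrite scl_rhoS; apply: inA_scl => //; rewrite absq; have := q01; lra.
Qed.

Lemma bnd_rhoS n f C : bnd (scl (rho n.+1) f) C -> bnd (scl (rho n) f) C.
Proof.
move=> h a; rewrite scl_rhoS coef_scl (absM habs) (absX habs) absq.
apply: Rle_trans (h a); rewrite -[X in (_ <= X)%coqR]Rmult_1_r.
apply: Rmult_le_compat_l; first exact: abs_ge0.
by rewrite -(pow1 (mdeg a)); apply: pow_incr; have := q01; lra.
Qed.

Lemma bnd_rho n k f C : (n <= k)%N -> bnd (scl (rho k) f) C -> bnd (scl (rho n) f) C.
Proof.
by move=> /subnK <-; elim: (k - n)%N => // j ih; rewrite addSn => /bnd_rhoS.
Qed.

(** U n is the product of the w l over l >= n. *)
Lemma infinite_product (w : nat -> fps F m) :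
  (forall n, inA (scl (rho n) (w n))) -> (forall n, w n 0%MM = 1) ->
  (forall n, lead (scl (rho n) (w n)) 0%MM) ->
  exists U : nat -> fps F m, forall n, [/\ U n = w n * U n.+1, inA (scl (rho n) (U n)) &
    lead (scl (rho n) (U n)) 0%MM].
Proof.
move=> Aw w1 lw.
have abs_w0 n : abs (scl (rho n) (w n) 0%MM) = 1%coqR.
  by rewrite coef_scl w1 mul1r mdeg0 expr0 (abs1 habs).
have wc n a : (a != 0)%MM -> (abs (scl (rho n) (w n) a) < 1)%coqR.
  move=> a0; have := proj2 (lw n) a; rewrite abs_w0.
  by case=> _; apply; rewrite lt_neqAle eq_sym a0 le0x.
have bw n : bnd (scl (rho n) (w n)) 1.
  by have := lead_bnd (lw n); rewrite abs_w0.
(* Non-constant coefficients are below 1 at radius |p|^(j + l). Passing to radius |p|^j gains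
   [q ^ l] per degree, and the degree is at least 1. *)
have bw1 j l : bnd (scl (rho j) (w (j + l)%N - 1)) (q ^ l)%coqR.
  move=> a; have [->|a0] := eqVneq a 0%MM.
    rewrite coef_scl coef_add coef_opp w1 coef_1 eqxx subrr mul0r (abs0 habs).
    exact: Rlt_le.
  rewrite coef_scl coef_add coef_opp coef_1 eq_sym (negbTE a0) subr0.
  have := wc (j + l)%N _ a0; rewrite coef_scl !(absM habs) !(absX habs).
  set x := abs (w _ _); set d := mdeg a => h.
  have d0 : (0 < d)%N by rewrite lt0n mdeg_eq0.
  have x0 : (0 <= x)%coqR by apply: abs_ge0.
  have pp n : (0 < abs p ^ n)%coqR by apply: pow_lt; lra.
  have e : ((abs p ^ (j + l)) ^ d = (abs p ^ j) ^ d * (abs p ^ l) ^ d)%coqR.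
    by rewrite -Rpow_mult_distr -Rdef_pow_add.
  have ld : (abs p ^ l <= (abs p ^ l) ^ d)%coqR.
    rewrite -[X in (X <= _)%coqR]pow_1; apply: Rle_pow; last by apply/ssrnat.leP.
    by apply: pow_R1_Rle; lra.
  rewrite pow_inv; apply: (Rmult_le_reg_r (abs p ^ l)) => //.
  rewrite Rinv_l; last by have := pp l; lra.
  rewrite e in h; apply: Rlt_le; apply: Rle_lt_trans h.
  rewrite -Rmult_assoc; apply: Rmult_le_compat_l => //.
  by apply: Rmult_le_pos => //; apply: pow_le; apply: Rlt_le.
pose V j N := \prod_(l < N) w (j + l)%N.
have VS j N : V j N.+1 = V j N * w (j + N)%N by rewrite /V big_ord_recr.
have V0 j : V j 0%N = 1 by rewrite /V big_ord0.
have VSl j N : V j N.+1 = w j * V j.+1 N.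
  rewrite /V big_ord_recl addn0; congr (_ * _); apply: eq_bigr => i _.
  by rewrite /= /bump add1n addnS addSn.
have b1 : bnd 1 1 by have := lead_bnd (lead1 habs m); rewrite coef_1 eqxx (abs1 habs).
have bV j N : bnd (scl (rho j) (V j N)) 1.
  elim: N => [|N ih]; first by rewrite V0 rmorph1.
  rewrite VS rmorphM -[X in bnd _ X]Rmult_1_r; apply: bndM => //.
  exact: bnd_rho (leq_addr _ _) (bw _).
have AV j N : inA (scl (rho j) (V j N)).
  elim: N => [|N ih]; first by rewrite V0 rmorph1; apply: inA1.
  rewrite VS rmorphM; apply: inAM => //; exact: inA_rho (leq_addr _ _) (Aw _).
have mono n k : (n <= k)%N -> (q ^ k <= q ^ n)%coqR.
  move=> /subnK <-; elim: (k - n)%N => [|i ih]; first exact: Rle_refl.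
  by apply: Rle_trans ih; rewrite addSn /=; have := qn (i + n)%N; have := q01; nra.
have cV j n k : (n <= k)%N -> bnd (scl (rho j) (V j k) - scl (rho j) (V j n)) (q ^ n)%coqR.
  move=> /subnK <-; elim: (k - n)%N => [|i ih].
    by rewrite subrr; apply: bnd0 => //; apply: Rlt_le.
  have -> : scl (rho j) (V j (i.+1 + n)%N) - scl (rho j) (V j n) =
     scl (rho j) (V j (i + n)%N) * scl (rho j) (w (j + (i + n))%N - 1) +
     (scl (rho j) (V j (i + n)%N) - scl (rho j) (V j n)).
    by rewrite addSn VS rmorphM rmorphB rmorph1; ring.
  apply: bndD => //; apply: (@bnd_le _ _ _ _ (1 * q ^ (i + n))%coqR).
    by rewrite Rmult_1_l; apply: mono; apply: leq_addl.
  exact: bndM.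
have lim eps : (0 < eps)%coqR -> exists n, (q ^ n < eps)%coqR.
  move=> e0; have [|N hN] := pow_lt_1_zero q _ eps e0.
    by rewrite Rabs_pos_eq; have := q01; lra.
  by exists N; have := hN N (le_n N); rewrite Rabs_pos_eq //; apply: Rlt_le.
have [Us hUs] : {Us : nat -> fps F m & forall j, inA (Us j) /\
    forall N, bnd (Us j - scl (rho j) (V j N)) (q ^ N)%coqR}.
  apply: (@choice _ _ (fun j u => inA u /\
    forall N, bnd (u - scl (rho j) (V j N)) (q ^ N)%coqR)) => j.
  apply: (fps_complete habs hcomp (V := fun N => scl (rho j) (V j N))) => //; exact: cV.
exists (fun j => scl (rho j)^-1 (Us j)) => j.
have sU i : scl (rho i) (scl (rho i)^-1 (Us i)) = Us i by rewrite sclM mulfV // scl1.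
rewrite sU; split; [|by case: (hUs j)|].
  apply: (scl_inj (rho0 j)); rewrite sU rmorphM /=; apply/eqP; rewrite -subr_eq0.
  apply/eqP/(bnd_eq0 habs) => eps /lim[n hn].
  apply: (@bnd_le _ _ _ _ (q ^ n)%coqR); first lra.
  set W := scl (rho j.+1)^-1 (Us j.+1).
  (* Both terms are compared with V j (n + 1) = w j * V (j + 1) n. *)
  have -> : Us j - scl (rho j) (w j) * scl (rho j) W =
     (Us j - scl (rho j) (V j n.+1)) - scl (rho j) (w j) * scl (rho j) (W - V j.+1 n).
    by rewrite VSl rmorphM rmorphB; ring.
  apply: bndB => //.
    by apply: bnd_le (proj2 (hUs j) n.+1); apply: mono.
  rewrite -[X in bnd _ X]Rmult_1_l; apply: bndM => //; apply: bnd_rhoS.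
  by rewrite rmorphB /= sU; apply: (proj2 (hUs _)).
(* V j 1 = w j, so U j is within q < 1 of w j and keeps the leading monomial 1. *)
have U1 a : (abs ((Us j - scl (rho j) (w j)) a) < 1)%coqR.
  have := proj2 (hUs j) 1%N a; rewrite VS V0 mul1r addn0 pow_1.
  by have := q01; lra.
have UE a : Us j a = scl (rho j) (w j) a + (Us j - scl (rho j) (w j)) a.
  by rewrite coef_add coef_opp addrC subrK.
have U01 : abs (Us j 0%MM) = 1%coqR.
  by rewrite UE (abs_dom habs) abs_w0.
have Ult a : (a != 0)%MM -> (abs (Us j a) < 1)%coqR.
  by move=> a0; rewrite UE; apply: absD_lt => //; apply: wc.
split; first by apply/eqP => /(abs_eq0 habs); rewrite U01; lra.
move=> b; rewrite U01; split.
  have [->|b0] := eqVneq b 0%MM; first by rewrite U01; lra.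
  by have := Ult _ b0; lra.
by move=> h; apply: Ult; apply/eqP => e; rewrite e ltxx in h.
Qed.

Lemma glue k (f : 'I_k -> fps F m) : (forall i, ent (f i)) ->
  exists G, forall n, gcdS inA (fun i => scl (rho n) (f i)) (scl (rho n) G).
Proof.
(* A non-zero f i0 makes all the gcds non-zero, so that they can be cancelled below. *)
move=> Ef; have [all0|/existsNP[i0 fi0]] := pselect (forall i, f i = 0).
  exists 0 => n; rewrite rmorph0; split=> [|i|H _ _]; [exact: inA0 | | exact: dvA0].
  by rewrite all0 rmorph0; apply: dvA0.
have p1' : (abs p^-1 <= 1)%coqR by rewrite absq; have := q01; lra.
have [G hG] : {G : nat -> fps F m & forall n,
    gcdS inA (fun i => scl (rho n) (f i)) (scl (rho n) (G n))}.
  apply: (@choice _ _ (fun n g => gcdS inA (fun i => scl (rho n) (f i)) (scl (rho n) g))) => n.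
  have a1 : (abs 1 <= 1)%coqR by rewrite (abs1 habs); lra.
  have [g [hg _]] := gcd_family (oner_neq0 F) a1 (fun i => Ef i _ (rho0 n)).
  by exists (scl (rho n)^-1 g); rewrite sclM mulfV // scl1.
have G0 n : scl (rho n) (G n) != 0.
  have [_ /(_ i0)[h _ e] _] := hG n; apply/eqP => g0; apply: fi0.
  by apply: (scl_inj (rho0 n)); rewrite e g0 mul0r rmorph0.
have [u hu] : {u : nat -> fps F m & forall n, [/\ G n.+1 = G n * u n,
    inA (scl (rho n) (u n)) & lead (scl (rho n) (u n)) 0%MM]}.
  apply: (@choice _ _ (fun n u => [/\ G n.+1 = G n * u,
    inA (scl (rho n) u) & lead (scl (rho n) u) 0%MM])) => n.
  (* G (n + 1), restricted to the ball of radius |p|^n, is a second gcd there; its quotient by G n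
     is a unit. *)
  have h1 : gcdS inA (fun i => scl (rho n) (f i)) (scl (rho n) (G n.+1)).
    have := gcd_restrict (r := p^-1) _ p1' (fun i => Ef i _ (rho0 n.+1)) (hG n.+1).
    rewrite invr_eq0 => /(_ p0); rewrite -scl_rhoS.
    by rewrite (_ : (fun i => _) = (fun i => scl (rho n) (f i))) //; apply: funext => i;
       rewrite [RHS]scl_rhoS.
  have [A1 d1 m1] := h1; have [A2 d2 m2] := hG n.
  have [us Aus e1] := m1 _ A2 d2; have [vs Avs e2] := m2 _ A1 d1.
  have uv : us * vs = 1.
    have z : scl (rho n) (G n) * (us * vs - 1) = 0.
      by rewrite mulrBr mulr1 mulrA -e1 -e2 subrr.
    have A3 : inA (us * vs - 1) by apply: inAB; [| exact: inAM | exact: inA1].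
    have [g0|/eqP] := inA_domain habs A2 A3 z; last by rewrite subr_eq0 => /eqP.
    by have := G0 n; rewrite g0 eqxx.
  exists (scl (rho n)^-1 us); have e : scl (rho n) (scl (rho n)^-1 us) = us.
    by rewrite sclM mulfV // scl1.
  rewrite e; split=> //; last exact: unit_lead0 uv.
  by apply: (scl_inj (rho0 n)); rewrite rmorphM /= e.
have k0 n : u n 0%MM != 0.
  by have [_ _ [+ _]] := hu n; rewrite coef_scl mdeg0 expr0 mulr1.
pose w n := cst m (u n 0%MM)^-1 * u n.
have wE n : scl (rho n) (w n) = cst m (u n 0%MM)^-1 * scl (rho n) (u n).
  by rewrite rmorphM /= scl_cst.
have [||| U hU] := @infinite_product w.
- by move=> n; rewrite wE; apply: inAM => //; [exact: inA_cst | case: (hu n)].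
- by move=> n; rewrite coef_cst mulVf.
- move=> n; rewrite wE -[X in lead _ X]addm0; apply: leadM => //; last by case: (hu n).
  by apply: lead_cst; rewrite invr_eq0.
(* Telescoping: each factor w n moves from U into G, the constants from normalisation accumulating
   in c. On the n-th ball the glued series is thus G n times a unit. *)
have step n : exists2 c, c != 0 & G 0%N * U 0%N = cst m c * (G n * U n).
  elim: n => [|n [c c0 E]]; first by exists 1; rewrite ?oner_neq0 // cst1 mul1r.
  exists (c * (u n 0%MM)^-1); first by rewrite mulf_neq0 ?invr_eq0.
  rewrite E -cstM; have [-> _ _] := hU n; have [-> _ _] := hu n; rewrite /w; ring.
exists (G 0%N * U 0%N) => n; have [c c0 ->] := step n.
have [_ AU lU] := hU n; have [v Av Uv] := lead0_unit habs hcomp AU lU.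
have [AG _ _] := hG n; have E : scl (rho n) (cst m c * (G n * U n)) =
    scl (rho n) (G n) * (cst m c * scl (rho n) (U n)).
  by rewrite !rmorphM /= scl_cst; ring.
apply: gcd_assoc (hG n) _ _ _; rewrite E.
- by apply: inAM => //; apply: inAM => //; apply: inA_cst.
- by exists (cst m c * scl (rho n) (U n)) => //; apply: inAM => //; apply: inA_cst.
exists (cst m c^-1 * v); first by apply: inAM => //; apply: inA_cst.
have cc : cst m c * cst m c^-1 = 1 by rewrite cstM mulfV // cst1.
transitivity (scl (rho n) (G n) * ((cst m c * cst m c^-1) * (scl (rho n) (U n) * v))).
  by rewrite cc Uv !mulr1.
by ring.
Qed.

Lemma radius_bound r : exists n, (abs r <= abs (rho n))%coqR.
Proof.
have [|N hN] := Pow_x_infinity (abs p) _ (abs r).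
  by rewrite Rabs_pos_eq; lra.
exists N; rewrite (absX habs); have := hN N (le_n N); rewrite Rabs_pos_eq; last first.
  by apply: pow_le; lra.
by move=> ?; lra.
Qed.

End Glue.

(** For non-zero f, cancellation shows that the quotients on larger balls agree with the one on the
    unit ball, which is therefore entire. *)
Lemma dv_ent f g : ent f -> ent g ->
  (forall r, r != 0 -> dvA (scl r f) (scl r g)) -> dvS ent f g.
Proof.
move=> Ef Eg h; have [h1 Ah1 e1] := h 1 (oner_neq0 F); rewrite !scl1 in e1.
have [f0|f0] := eqVneq f 0.
  by exists 0; [move=> r _; rewrite rmorph0; exact: inA0 | rewrite e1 f0 !mul0r].
exists h1 => // r r0; have [r1|r1] := Rle_lt_dec (abs r) 1; first exact: inA_scl.
have [hr Ahr er] := h r r0.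
have ri1 : (abs r^-1 <= 1)%coqR.
  rewrite (absV habs) //; rewrite -Rinv_1; apply: Rinv_le_contravar; lra.
have z : f * (scl r^-1 hr - h1) = 0.
  rewrite mulrBr -e1; apply/eqP; rewrite subr_eq0; apply/eqP.
  by apply: (scl_inj r0); rewrite rmorphM /= sclM mulfV // scl1 -er.
have A3 : inA (scl r^-1 hr - h1) by apply: inAB => //; apply: inA_scl.
have Af : inA f by have := Ef 1 (oner_neq0 F); rewrite scl1.
have [f0'|/eqP] := inA_domain habs Af A3 z; first by rewrite f0' eqxx in f0.
by rewrite subr_eq0 => /eqP<-; rewrite sclM mulfV // scl1.
Qed.

(** Every radius lies below some |p|^n, from which [gcd_restrict] descends; [dv_ent] then turns
    divisibility on all balls into divisibility among entire functions. *)
Theorem entire_gcd k (f : 'I_k -> fps F m) : (forall i, ent (f i)) ->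
  exists G, gcdS ent f G /\ forall r, r != 0 -> gcdS inA (fun i => scl r (f i)) (scl r G).
Proof.
move=> Ef; have [p p0 p1] := big_radius; have [G hG] := glue p0 p1 Ef.
have all r : r != 0 -> gcdS inA (fun i => scl r (f i)) (scl r G).
  move=> r0; have [n rn] := radius_bound p1 r.
  have pn : p ^+ n != 0 by apply: expf_neq0.
  have t1 : (abs (r / p ^+ n) <= 1)%coqR.
    have pp := abs_gt0 habs pn; rewrite (absM habs) (absV habs) //.
    by apply: (Rmult_le_reg_r (abs (p ^+ n))) => //; rewrite Rmult_assoc Rinv_l; lra.
  have t0 : r / p ^+ n != 0 by rewrite mulf_neq0 ?invr_eq0.
  have := gcd_restrict t0 t1 (fun i => Ef i _ pn) (hG n); rewrite sclM divfK //.
  by rewrite (_ : (fun i => _) = (fun i => scl r (f i))) //; apply: funext => i;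
     rewrite sclM divfK.
exists G; split=> //; have EG : ent G by move=> r /all[].
split=> // [i|H EH Hf]; apply: dv_ent => // r r0; first by case: (all r r0).
have [_ _ mx] := all r r0; apply: mx; first exact: EH.
by move=> i; have [h Eh ->] := Hf i; exists (scl r h); rewrite ?rmorphM //; apply: Eh.
Qed.

(** Two gcds among entire functions divide each other there, hence on each ball, and the one from
    [entire_gcd] is a gcd on that ball. *)
Theorem entire_gcd_restrict k (f : 'I_k -> fps F m) G r : (forall i, ent (f i)) ->
  gcdS ent f G -> r != 0 -> gcdS inA (fun i => scl r (f i)) (scl r G).
Proof.
move=> Ef [EG Gf mx] r0; have [K [[EK Kf kx] hK]] := entire_gcd Ef.
have dr f' g' : dvS ent f' g' -> dvA (scl r f') (scl r g').
  by move=> [h Eh ->]; exists (scl r h); rewrite ?rmorphM //; apply: Eh.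
apply: gcd_assoc (hK r r0) _ _ _; [exact: EG | exact/dr/mx | exact/dr/kx].
Qed.

End Families.

(** * Back to multi-indexed families of coefficients *)

Section Pseries.
Variables (F : closedFieldType) (m : nat).
Implicit Types f g : pseries F m.

Definition mnm_of (c : mindex m) : 'X_{1..m} := [multinom c i | i < m].
Definition mindex_of (a : 'X_{1..m}) : mindex m := [ffun i => a i].

Lemma mnm_ofK : cancel mnm_of mindex_of.
Proof. by move=> c; apply/ffunP => i; rewrite ffunE mnmE. Qed.
Lemma mindex_ofK : cancel mindex_of mnm_of.
Proof. by move=> a; apply/mnmP => i; rewrite mnmE ffunE. Qed.
Lemma mdeg_mnm_of c : mdeg (mnm_of c) = Defs.mdeg c.
Proof. by rewrite mdegE; apply: eq_bigr => i _; rewrite mnmE. Qed.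

Definition fps_of f : fps F m := Fps (fun a => f (mindex_of a)).
Definition pseries_of (h : fps F m) : pseries F m := fun c => h (mnm_of c).

Lemma fps_ofK : cancel fps_of pseries_of.
Proof. by move=> f; apply: funext => c; rewrite /pseries_of /= mnm_ofK. Qed.
Lemma pseries_ofK : cancel pseries_of fps_of.
Proof. by move=> h; apply: fpsP => a; rewrite /= /pseries_of mindex_ofK. Qed.

(** The box indexing [psmul], cut down to the indices below gamma, is one more enumeration for
    [coef_mul_seq]. *)
Lemma fps_of_psmul f g : fps_of (psmul f g) = fps_of f * fps_of g.
Proof.
apply: fpsP => a; set c := mindex_of a.
have cE i : c i = a i by rewrite ffunE.
pose T := {ffun 'I_m -> 'I_(Defs.mdeg c).+1}.
pose s := map (fun x : T => mnm_of (mi_of x))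
  (filter (fun x : T => [forall i, (x i <= c i)%N]) (index_enum T)).
rewrite (@coef_mul_seq _ _ s).
- rewrite big_map big_filter; apply: eq_bigr => x _ /=.
  rewrite mnm_ofK; congr (_ * g _); apply/ffunP => i.
  by rewrite !ffunE mnmBE mnmE ffunE.
- rewrite map_inj_uniq ?filter_uniq ?index_enum_uniq // => x y e.
  apply/ffunP => i; apply: val_inj; have := congr1 (fun b : 'X_{1..m} => b i) e.
  by rewrite !mnmE !ffunE.
move=> b; rewrite inE; apply/mapP/mnm_lepP => [[x]|ba].
  by rewrite mem_filter => /andP[/forallP h _] -> i; rewrite mnmE ffunE -cE.
have lt i : (b i < (Defs.mdeg c).+1)%N.
  rewrite ltnS; apply: leq_trans (ba i) _; rewrite -cE /Defs.mdeg (bigD1 i) //=.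
  exact: leq_addr.
exists [ffun i => Ordinal (lt i)].
  rewrite mem_filter mem_index_enum andbT; apply/forallP => i; rewrite ffunE cE; exact: ba.
by apply/mnmP => i; rewrite mnmE !ffunE.
Qed.

Lemma ps_dividesE S f g :
  ps_divides S g f <-> dvS (fun h => S (pseries_of h)) (fps_of g) (fps_of f).
Proof.
split=> [[h [Sh e]]|[h Sh e]].
  exists (fps_of h); rewrite ?fps_ofK //.
  by rewrite -fps_of_psmul; congr fps_of; apply: funext.
exists (pseries_of h); split=> // c; rewrite -{1}(fps_ofK f) e -{1}(pseries_ofK h).
by rewrite -fps_of_psmul fps_ofK.
Qed.

Lemma ps_is_gcdE k S (f : 'I_k -> pseries F m) G :
  ps_is_gcd S f G <-> gcdS (fun h => S (pseries_of h)) (fun i => fps_of (f i)) (fps_of G).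
Proof.
split=> [[SG [Gf mx]]|[SG Gf mx]].
  split=> [|i|H SH Hf]; [by rewrite fps_ofK | exact/ps_dividesE |].
  rewrite -(pseries_ofK H); apply/ps_dividesE/mx => // i; apply/ps_dividesE.
  by rewrite pseries_ofK.
rewrite fps_ofK in SG; split=> //; split=> [i|H SH Hf]; first exact/ps_dividesE.
by apply/ps_dividesE/mx => [|i]; rewrite ?fps_ofK //; apply/ps_dividesE.
Qed.

Variables (abs : F -> R) (habs : is_nonarch_abs abs).

Lemma in_AE r f : in_A abs (abs r) f <-> inA abs (scl r (fps_of f)).
Proof.
split=> h e /h[N hN]; exists N => a Na.
  by rewrite coef_scl (absM habs) (absX habs) -(mindex_ofK a) mdeg_mnm_of mindex_ofK;
     apply: hN; rewrite -mdeg_mnm_of mindex_ofK.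
have := hN (mnm_of a); rewrite mdeg_mnm_of => /(_ Na).
by rewrite coef_scl (absM habs) (absX habs) mdeg_mnm_of /= mnm_ofK.
Qed.

Lemma entireE f : entire abs f <-> ent abs (fps_of f).
Proof.
split=> h r; first by move=> /eqP r0; apply/in_AE/h; exists r.
by move=> [a [/eqP a0 <-]]; apply/in_AE/h.
Qed.

Lemma dvS_scl r (f g : fps F m) : r != 0 ->
  dvS (fun h => inA abs (scl r h)) f g <-> dvS (inA abs) (scl r f) (scl r g).
Proof.
move=> r0; split=> [[h Ah ->]|[h Ah e]]; first by exists (scl r h); rewrite ?rmorphM.
have hE : scl r (scl r^-1 h) = h by rewrite sclM mulfV // scl1.
exists (scl r^-1 h); rewrite ?hE //; apply: (scl_inj r0).
by rewrite rmorphM /= hE.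
Qed.

(** Rescaling is an isomorphism from the ring of the ball of radius |r| onto that of the unit
    ball. *)
Lemma gcdS_scl r k (f : 'I_k -> fps F m) G : r != 0 ->
  gcdS (inA abs) (fun i => scl r (f i)) (scl r G) -> gcdS (fun h => inA abs (scl r h)) f G.
Proof.
move=> r0 [AG Gf mx]; split=> // [i|H AH Hf]; first exact/dvS_scl.
by apply/dvS_scl/mx => // i; apply/dvS_scl.
Qed.
End Pseries.

Theorem mainTheorem1 (F : closedFieldType) (abs : F -> R)
    (habs : is_nonarch_abs abs) (hnt : abs_nontrivial abs)
    (hcomp : abs_complete abs)
    (m k : nat) (f : 'I_k -> pseries F m)
    (hf : forall i : 'I_k, entire abs (f i)) :
  (exists G : pseries F m, ps_is_gcd (@entire F abs m) f G) /\
  (forall G : pseries F m, ps_is_gcd (@entire F abs m) f G ->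
     forall r : R, in_value_group abs r -> ps_is_gcd (@in_A F abs m r) f G).
Proof.
have Ef i : ent abs (fps_of (f i)) by apply/(entireE habs).
have entE : (fun h : fps F m => entire abs (pseries_of h)) = @ent F abs m.
  apply: funext => h; apply: propext; split=> [/(entireE habs)|e].
    by rewrite pseries_ofK.
  by apply/(entireE habs); rewrite pseries_ofK.
split=> [|G /ps_is_gcdE].
  have [G [hG _]] := entire_gcd habs hcomp hnt Ef.
  by exists (pseries_of G); apply/ps_is_gcdE; rewrite entE pseries_ofK.
rewrite entE => hG _ [r [/eqP r0 <-]]; apply/ps_is_gcdE.
have -> : (fun h : fps F m => in_A abs (abs r) (pseries_of h)) = (fun h => inA abs (scl r h)).
  apply: funext => h; apply: propext; split=> [/(in_AE habs)|e].
    by rewrite pseries_ofK.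
  by apply/(in_AE habs); rewrite pseries_ofK.
exact/gcdS_scl/(entire_gcd_restrict habs hcomp hnt).
Qed.
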